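(* Let $\mathcal{G}$ be a metric graph satisfying the standing hypotheses (i)–(vi) listed in the context, let $\sigma>1$, let $V:\mathcal{G}\to\mathbb{R}$ be positive, fix $\delta>0$ and $R\ge R_0=\max\{2j,1\}$, and let $\alpha=\delta/R>0$. Suppose that $u$ is a solution of $\Delta_{\mathcal{G}}u+V|u|^\sigma\le0$ in $\mathcal{G}$ (in particular $[\mathcal{K}(u)](x)=0$ for every $x\in\mathcal{V}$), that $u\in X_\alpha$, and let $\Psi(x)=\psi\big((\tilde d(x,x_0)-j)/R\big)$ be the function defined in the context. Then $$\int_{\mathcal{G}}\Psi(\Delta_{\mathcal{V}}u)\,d\mu_{\mathcal{V}}+\int_{\mathcal{G}}\Psi(\Delta_{\mathcal{E}}u)\,d\mu_{\mathcal{E}}=\int_{\mathcal{G}}u(\Delta_{\mathcal{V}}\Psi)\,d\mu_{\mathcal{V}}+\int_{\mathcal{G}}u(\Delta_{\mathcal{E}}\Psi)\,d\mu_{\mathcal{E}}.$$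
   Context: **Metric graph.** Let $(\mathcal{V},E,l)$ be a weighted graph: $\mathcal{V}$ a countable set of vertices, $E$ a countable set of edges, $l:E\to(0,+\infty]$, $l_e:=l(e)$ the length of $e$. The metric graph $\mathcal{G}$ over $(\mathcal{V},E,l)$ is the pair $(\mathcal{V},\mathcal{E})$ with $\mathcal{E}=\bigcup_{e\in E}\{e\}\times(0,l_e)$; its points are the vertices and the interior points of edges. Each edge $e$ has an initial vertex $i(e)$ and a final vertex $j(e)$; $e$ is identified with $I_e=(0,l_e)$, and $i(e),j(e)$ correspond to the endpoints $0,l_e$ of $\overline{I}_e=[0,l_e]$. Write $e\ni v$ if $v=i(e)$ or $v=j(e)$, and $y\sim x$ if the vertices $x,y$ are joined by an edge. (One writes $e\in\mathcal{E}$ for edges too.) For $x,y\in\mathcal{G}$, $d(x,y)$ is the infimum of the lengths of paths in $\mathcal{G}$ joining $x$ and $y$ (interior points may be added as vertices). $B_R(x_0)=\{x\in\mathcal{G}: d(x,x_0)<R\}$. **Functions, measures, Laplacians.** For $f:\mathcal{G}\to\mathbb{R}$, $f_e$ is its restriction to $\overline{I}_e$. $C(\mathcal{G})$ is the set of $f$ with every $f_e\in C([0,l_e])$ and a common value at each vertex from all incident edges. $\mu_{\mathcal{V}}:\mathcal{V}\to(0,\infty)$ is a vertex measure; $\int_{\mathcal{G}}f\,d\mu_{\mathcal{V}}=\sum_{x\in\mathcal{V}}\mu_{\mathcal{V}}(x)f(x)$ and $\int_{\mathcal{G}}f\,d\mu_{\mathcal{E}}=\sum_e\int_0^{l_e}f_e(x)\,dx$.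 For $\alpha>0$, $X_\alpha=L^1_{e^{-\alpha d(\cdot,x_0)}}(\mathcal{G})$ is the set of $f$ with $\sum_{x\in\mathcal{V}}\mu_{\mathcal{V}}(x)|f(x)|e^{-\alpha d(x,x_0)}+\sum_e\int_0^{l_e}|f_e(x)|e^{-\alpha d(x,x_0)}dx<+\infty$. $\omega:E\to(0,\infty)$ is a symmetric positive weight. For a vertex $x$, $\Delta_{\mathcal{V}}f(x)=\frac{1}{\mu_{\mathcal{V}}(x)}\sum_{y\sim x}\omega(x,y)(f(y)-f(x))$; for $x\in I_e$, $\Delta_{\mathcal{E}}f(x)=f_e''(x)$. Formally $\Delta_{\mathcal{G}}f=(\Delta_{\mathcal{V}}f)\,d\mu_{\mathcal{V}}+(\Delta_{\mathcal{E}}f)\,d\mu_{\mathcal{E}}$. $$\mathcal{D}(\mathcal{G})=\{f\in C(\mathcal{G}): f_e\in C^2(I_e)\cap C^1(\overline{I}_e),\ f_e''\in L^\infty(I_e)\ \forall e\}.$$ For a vertex $v\in e$, $\frac{df_e(v)}{dn}=f_e'(v)$ if $j(e)=v$ and $=-f_e'(v)$ if $i(e)=v$; $[\mathcal{K}(f)](x)=\sum_{e\ni x}\frac{df_e(x)}{dn}$. **Solutions.** $u$ is a solution of $\Delta_{\mathcal{G}}u+V|u|^\sigma\le0$ in $\mathcal{G}$ if $u\in\mathcal{D}(\mathcal{G})$, $u_e''(x)+V_e(x)|u_e(x)|^\sigma\le0$ for every edge $e$ and $x\in(0,l_e)$, $\Delta_{\mathcal{V}}u(x)+V(x)|u(x)|^\sigma\le0$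 for every $x\in\mathcal{V}$, and $[\mathcal{K}(u)](x)=0$ for every $x\in\mathcal{V}$. **Standing hypotheses.** (i) $\mathcal{G}$ is infinite, connected, locally finite. (ii) $l_e<+\infty$ and $i(e)\ne j(e)$ for all edges $e$. (iii) There are a vertex $x_0\in\mathcal{V}$ and a sequence $\{x_n\}\subset\mathcal{V}$ with $d(x_n,x_0)\to+\infty$. (iv) For every $R>0$ the ball $B_R(x_0)$ is finite, i.e. involves only finitely many vertices and edges. (v) There is $C>0$ with $\sum_{y\sim x}\omega(x,y)\le C\mu_{\mathcal{V}}(x)$ for every $x\in\mathcal{V}$. (vi) $j:=\sup_e l_e<\infty$ and $r:=\inf_e l_e>0$. **Modified distance.** On each edge, $x\mapsto d(x,x_0)$ is either $d(i(e),x_0)+x$, or $d(j(e),x_0)+l_e-x$, or there is an interior point $q_e$ such that it equals $d(i(e),x_0)+x$ on $[0,q_e]$ and $d(j(e),x_0)+l_e-x$ on $[q_e,l_e]$; $\mathcal{V}_0$ is the set of such points $q_e$. Fix a $C^3$ function $\eta:[0,1]\to[0,1]$ with $\eta(0)=0$, $\eta(1)=1$, $\eta'_+(0)=\eta'_-(1)=0$, $\eta''_+(0)=\eta''_-(1)=0$, $\eta'\ge0$ on $(0,1)$, and $|\eta'|,|\eta''|\le C$. Define $\tilde x_e:[0,l_e]\to[0,l_e]$ by $\tilde x_e(x)=l_e\eta(x/l_e)$ if $e\cap\mathcal{V}_0=\emptyset$, and if $e\cap\mathcal{V}_0=\{q_e\}$ by $\tilde x_e(x)=q_e\eta(2x/l_e)$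 on $[0,l_e/2]$ and $\tilde x_e(x)=(l_e-q_e)\eta\big((2x-l_e)/l_e\big)+q_e$ on $[l_e/2,l_e]$. The modified distance is $\tilde d(\cdot,x_0):\mathcal{G}\to\mathbb{R}$ with $\tilde d_e(x,x_0)=d(\tilde x_e(x),x_0)$ on each edge. **Test function.** $\psi:[-j/R,\infty)\to(0,\infty)$ is a $C^2$ function with $\psi\equiv1$ on $[-j/R,1]$, $\psi(t)=e^{-\delta t}$ on $[2,\infty)$, and $\psi'\le0$; consequently there are $C_1,C_2>0$ with $C_2e^{-\delta t}\le\psi(t)\le C_1e^{-\delta t}$ and $|\psi'(t)|,|\psi''(t)|\le C_1e^{-\delta t}$ on $[-j/R,\infty)$. $\Psi(x)=\psi\big((\tilde d(x,x_0)-j)/R\big)$ for $x\in\mathcal{G}$. *)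

(* Defs.v *)
From HB Require Import structures.
From mathcomp Require Import all_boot all_order all_algebra.
From mathcomp Require Import all_classical all_reals all_analysis.

Set Implicit Arguments.
Unset Strict Implicit.
Unset Printing Implicit Defensive.

Import Order.TTheory GRing.Theory Num.Theory.
Import numFieldNormedType.Exports.

Local Open Scope classical_set_scope.
Local Open Scope ring_scope.

Section CalculusOn.
Context {R : realType}.
Implicit Types (A : set R) (f : R -> R).

(* The difference quotient is restricted to [A]: at an endpoint of an interval
   this is the one-sided derivative, at an interior point it is [derive1 f]. *)
Definition diff_quot_on A f x : set_system R :=
  (f y - f x) / (y - x) @[y --> within A x^'].

Definition derivable_on A f x : Prop := cvg (diff_quot_on A f x).

Definition derive_on A f : R -> R := fun x => lim (diff_quot_on A f x).

Fixpoint C_on (k : nat) A f : Prop :=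
  {within A, continuous f} /\
  if k is k'.+1 then
    (forall x, A x -> derivable_on A f x) /\ C_on k' A (derive_on A f)
  else True.

End CalculusOn.

(* Lengths are real numbers: edges of infinite length are excluded. *)
Record metric_graph (R : realType) := MetricGraph {
  vertex : countType;
  edge : countType;
  ini : edge -> vertex;
  fin : edge -> vertex;
  len : edge -> R;
  len_gt0 : forall e, 0 < len e
}.

Section MetricGraph.
Context {R : realType} (G : metric_graph R).

(* A point is a vertex, or a pair (e, t) with 0 < t < l_e. *)
Definition gpoint : Type :=
  (vertex G + {p : edge G * R | 0 < p.2 < len p.1})%type.

Definition vpt (v : vertex G) : gpoint := inl v.

(* The point of coordinate [t] in [0, l_e] on the closed edge [e]; coordinates
   outside [0, l_e] are sent to the nearest endpoint. *)
Definition ept (e : edge G) (t : R) : gpoint :=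
  if insub (e, t) is Some p then inr p
  else vpt (if t <= 0 then ini e else fin e).

(* The restriction f_e. A function on points has by construction a common value
   at a vertex from all incident edges. *)
Definition on_edge (f : gpoint -> R) (e : edge G) : R -> R := fun t => f (ept e t).

Definition incident (v : vertex G) (e : edge G) : Prop := ini e = v \/ fin e = v.

Definition adj (x y : vertex G) : Prop :=
  exists e, (ini e = x /\ fin e = y) \/ (ini e = y /\ fin e = x).

(* [gpath x y L]: there is a path of length [L] from [x] to [y], i.e. a finite
   chain of segments, each of them contained in a closed edge. The end points
   of the segments need not be vertices. *)
Inductive gpath : gpoint -> gpoint -> R -> Prop :=
| gpath_nil x : gpath x x 0
| gpath_cons e (s t : R) y L :
    0 <= s <= len e -> 0 <= t <= len e -> gpath (ept e t) y L ->
    gpath (ept e s) y (`|s - t| + L).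

Definition dist (x y : gpoint) : R := inf [set L | gpath x y L].

Definition connected_graph : Prop := forall x y, exists L, gpath x y L.

Definition locally_finite : Prop :=
  forall v, finite_set [set e | incident v e].

Definition finite_ball (x0 : gpoint) (rho : R) : Prop :=
  finite_set [set v | dist (vpt v) x0 < rho] /\
  finite_set [set e | exists2 t : R, 0 < t < len e & dist (ept e t) x0 < rho].

Definition max_len : R := sup (range (@len R G)).
Definition min_len : R := inf (range (@len R G)).

Record standing_hypotheses (mu : vertex G -> R)
    (omega : vertex G -> vertex G -> R) (x0 : vertex G) : Prop := {
  graph_infinite : infinite_set [set: vertex G];
  graph_connected : connected_graph;
  graph_locally_finite : locally_finite;
  graph_loopless : forall e : edge G, ini e <> fin e;
  graph_unbounded : exists x_ : nat -> vertex G,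
    dist (vpt (x_ n)) (vpt x0) @[n --> \oo] --> +oo;
  graph_finite_balls : forall rho : R, 0 < rho -> finite_ball (vpt x0) rho;
  graph_weight_bound : exists2 C : R, 0 < C &
    forall x, \sum_(y \in [set y | adj x y]) omega x y <= C * mu x;
  graph_len_bounded : has_ubound (range (@len R G));
  graph_len_pos : 0 < min_len
}.

(* The sum of a family over a countable type, as the difference of the sums of
   its positive and negative parts. *)
Definition total_sum (I : choiceType) (F : I -> \bar R) : \bar R :=
  (\esum_(i in [set: I]) F^\+ i - \esum_(i in [set: I]) F^\- i)%E.

Definition int_V (mu g : vertex G -> R) : \bar R :=
  total_sum (fun v => (mu v * g v)%:E).

Definition integrable_V (mu g : vertex G -> R) : Prop :=
  summable [set: vertex G] (fun v => (mu v * g v)%:E).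

(* Integrands on the edges are given as [g e t] with [t] in (0, l_e). *)
Definition int_E (g : edge G -> R -> R) : \bar R :=
  total_sum (fun e => \int[lebesgue_measure]_(t in `]0%R, len e[) (g e t)%:E)%E.

Definition integrable_E (g : edge G -> R -> R) : Prop :=
  (forall e, lebesgue_measure.-integrable `]0, len e[ (EFin \o g e)) /\
  (\esum_(e in [set: edge G])
      \int[lebesgue_measure]_(t in `]0%R, len e[) `|g e t|%R%:E < +oo)%E.

Definition X_space (mu : vertex G -> R) (x0 : gpoint) (alpha : R)
    (f : gpoint -> R) : Prop :=
  (\esum_(v in [set: vertex G])
      (mu v * `|f (vpt v)| * expR (- (alpha * dist (vpt v) x0)))%R%:E +
   \esum_(e in [set: edge G]) \int[lebesgue_measure]_(t in `]0%R, len e[)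
      (`|on_edge f e t| * expR (- (alpha * dist (ept e t) x0)))%R%:E < +oo)%E.

Definition lap_V (mu : vertex G -> R) (omega : vertex G -> vertex G -> R)
    (f : gpoint -> R) (x : vertex G) : R :=
  (mu x)^-1 *
  \sum_(y \in [set y | adj x y]) omega x y * (f (vpt y) - f (vpt x)).

(* Only used for [t] in (0, l_e). *)
Definition lap_E (f : gpoint -> R) (e : edge G) (t : R) : R :=
  derive1n 2 (on_edge f e) t.

Record in_domain (f : gpoint -> R) : Prop := {
  domain_continuous : forall e, {within `[0, len e], continuous (on_edge f e)};
  domain_C2 : forall e (t : R), 0 < t < len e ->
    [/\ derivable (on_edge f e) t 1, derivable (derive1 (on_edge f e)) t 1
      & {for t, continuous (derive1n 2 (on_edge f e))}];
  domain_C1 : forall e, C_on 1 `[0, len e] (on_edge f e);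
  domain_Linfty : forall e, exists M : R,
    {ae lebesgue_measure, forall t : R, 0 < t < len e -> `|lap_E f e t| <= M}
}.

(* The outward normal derivative; [e] is assumed incident to [v] and not a
   loop. *)
Definition normal_deriv (f : gpoint -> R) (e : edge G) (v : vertex G) : R :=
  if fin e == v then derive_on `[0, len e] (on_edge f e) (len e)
  else - derive_on `[0, len e] (on_edge f e) 0.

Definition kirchhoff (f : gpoint -> R) (v : vertex G) : R :=
  \sum_(e \in [set e | incident v e]) normal_deriv f e v.

Record is_solution (mu : vertex G -> R) (omega : vertex G -> vertex G -> R)
    (V : gpoint -> R) (sigma : R) (u : gpoint -> R) : Prop := {
  solution_domain : in_domain u;
  solution_E : forall e (t : R), 0 < t < len e ->
    lap_E u e t + V (ept e t) * `|u (ept e t)| `^ sigma <= 0;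
  solution_V : forall v,
    lap_V mu omega u v + V (vpt v) * `|u (vpt v)| `^ sigma <= 0;
  solution_kirchhoff : forall v, kirchhoff u v = 0
}.

(* [q] is the interior point q_e at which d(., x0) switches branch on [e];
   there is at most one. *)
Definition is_break (x0 : gpoint) (e : edge G) (q : R) : Prop :=
  [/\ 0 < q < len e,
      forall t : R, 0 <= t <= q -> dist (ept e t) x0 = dist (vpt (ini e)) x0 + t &
      forall t : R, q <= t <= len e ->
        dist (ept e t) x0 = dist (vpt (fin e)) x0 + len e - t].

Definition mod_coord (eta : R -> R) (x0 : gpoint) (e : edge G) (t : R) : R :=
  let l := len e in
  if `[< exists q, is_break x0 e q >] then
    let q := xget 0 [set q | is_break x0 e q] in
    if t <= l / 2 then q * eta (2 * t / l)
    else (l - q) * eta ((2 * t - l) / l) + q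
  else l * eta (t / l).

(* At a vertex this agrees with the formula on the incident edges when
   [eta 0 = 0] and [eta 1 = 1]. *)
Definition mod_dist (eta : R -> R) (x0 : gpoint) (x : gpoint) : R :=
  match x with
  | inl v => dist (vpt v) x0
  | inr p => let: (e, t) := val p in dist (ept e (mod_coord eta x0 e t)) x0
  end.

Definition test_fun (eta psi : R -> R) (x0 : gpoint) (rho : R) (x : gpoint) : R :=
  psi ((mod_dist eta x0 x - max_len) / rho).

End MetricGraph.

Record is_eta {R : realType} (eta : R -> R) : Prop := {
  eta_C3 : C_on 3 `[0, 1] eta;
  eta_range : forall t : R, 0 <= t <= 1 -> 0 <= eta t <= 1;
  eta_0 : eta 0 = 0;
  eta_1 : eta 1 = 1;
  eta_d1_0 : derive_on `[0, 1] eta 0 = 0;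
  eta_d1_1 : derive_on `[0, 1] eta 1 = 0;
  eta_d2_0 : derive_on `[0, 1] (derive_on `[0, 1] eta) 0 = 0;
  eta_d2_1 : derive_on `[0, 1] (derive_on `[0, 1] eta) 1 = 0;
  eta_d1_ge0 : forall t : R, 0 < t < 1 -> 0 <= derive_on `[0, 1] eta t;
  eta_bounded : exists C : R, forall t : R, 0 <= t <= 1 ->
    `|derive_on `[0, 1] eta t| <= C /\
    `|derive_on `[0, 1] (derive_on `[0, 1] eta) t| <= C
}.

(* [a] is the left endpoint of the domain of [psi]. *)
Record is_psi {R : realType} (a delta : R) (psi : R -> R) : Prop := {
  psi_C2 : C_on 2 `[a, +oo[ psi;
  psi_gt0 : forall t : R, a <= t -> 0 < psi t;
  psi_1 : forall t : R, a <= t <= 1 -> psi t = 1;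
  psi_exp : forall t : R, 2 <= t -> psi t = expR (- (delta * t));
  psi_d1_le0 : forall t : R, a <= t -> derive_on `[a, +oo[ psi t <= 0
}.

(* Main.v *)
Require Import Defs.
From HB Require Import structures.
From mathcomp Require Import all_boot all_order all_algebra.
From mathcomp Require Import all_classical all_reals all_analysis.
From mathcomp Require Import measurable_realfun.
From mathcomp Require Import ring lra.

Set Implicit Arguments.
Unset Strict Implicit.
Unset Printing Implicit Defensive.

Import Order.TTheory GRing.Theory Num.Theory.
Import numFieldNormedType.Exports.

Local Open Scope classical_set_scope.
Local Open Scope ring_scope.

(** The identity splits into one for the vertices and one for the edges. After an
    integration by parts on the edges each is an exchange of two summations, and
    most of the work is in showing that the double sums converge absolutely.

    The test function [Psi] and its second derivative along the edges are bounded
    by a constant times [exp (- alpha d(x, x0))]. For this the profiles [eta] and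
    [psi] are continued to the whole line ([eta_extension], [psi_extension]). On
    each edge the distance to [x0] is the minimum of the two routes through the
    end points ([dist_edge]), so that the modified distance is a sum of at most
    two rescaled copies of [eta] ([mod_dist_two_steps]), with derivatives bounded
    in terms of the extreme edge lengths and vanishing at the vertices
    ([test_fun_jets]).

    At the vertices, [Psi Delta u] and [u Delta Psi] differ by the exchange of the
    roles of [x] and [y] in the double sum of [omega x y Psi x u y], which
    converges absolutely because the distance changes by at most the maximal edge
    length between neighbours and the total weight at [x] is at most a multiple of
    [mu x] ([vertex_green]).

    On an edge, integrating by parts twice gives the integral of [u Psi''] plus
    the boundary values of [Psi u'], as [Psi'] vanishes at the end points
    ([integration_by_parts_edge], [edge_identity]). Summed over the edges and
    regrouped by vertices, the boundary values give [Psi] times the Kirchhoff sum,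
    that is 0. What must be shown is that they are absolutely summable, although
    the space to which [u] belongs gives no control on derivatives. The
    differential inequality makes [u] concave on every edge, so its outward slopes
    are bounded above by its integral over the edge ([concave_end_slopes]).
    Kirchhoff's condition converts this one-sided bound into a bound on absolute
    values, because the slopes at a vertex sum to zero ([boundary_terms_cancel]).
    The integrability of [Psi u''] then follows from its constant sign
    ([edge_green]). *)

(** * A fundamental theorem of calculus on open intervals *)

Section FTC.
Context {R : realType}.
Notation leb := (@lebesgue_measure R).

Lemma integrable_oo_cc (f : R -> R) a b :
  leb.-integrable `]a, b[ (EFin \o f) -> leb.-integrable `[a, b] (EFin \o f).
Proof.
move=> /integrableP[mf fi]; apply/integrableP; split.
  exact: emeasurable_fun_itv_cc mf.
by rewrite integral_itv_bndoo//; exact: measurableT_comp.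
Qed.

(** The second derivative of a function in the domain of the Laplacian is
    continuous only on the open edge, so the fundamental theorem is needed for a
    derivative that is merely integrable there: [F] and the integral of [f] from
    [a] are both continuous on the closed interval and have the same derivative
    inside, so the mean value theorem applies to their difference. *)
Lemma FTC2_oo (f F : R -> R) a b : a < b ->
  leb.-integrable `]a, b[ (EFin \o f) ->
  (forall x, x \in `]a, b[ -> {for x, continuous f}) ->
  {within `[a, b], continuous F} ->
  (forall x, x \in `]a, b[ -> is_derive x 1 F (f x)) ->
  (\int[leb]_(x in `]a, b[) (f x)%:E = (F b - F a)%:E)%E.
Proof.
move=> ab fi fc Fc Fd.
have fi' := integrable_oo_cc fi.
pose G x := (\int[leb]_(t in `[a, x]) f t)%R.
have Gc : {within `[a, b], continuous G}.
  exact: parameterized_integral_continuous (ltW ab) fi'.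
have Gd x : x \in `]a, b[ -> is_derive x 1 G (f x).
  move=> xab; have /andP[ax xb] : (a < x) && (x < b) by move: xab; rewrite in_itv.
  have [Gd Ge] := continuous_FTC1_closed xb fi' ax (fc _ xab).
  by rewrite -Ge derive1E; exact: derivableP.
have [||c cab] := @MVT _ (F \- G) (fun=> 0) a b ab.
- move=> x xab; have := Fd _ xab; have := Gd _ xab => dG dF.
  by apply: is_derive_eq; rewrite subrr.
- by move=> x; apply: continuousB; [exact: Fc|exact: Gc].
have G0 : G a = 0 by rewrite /G set_itv1 Rintegral_set1.
rewrite /= mul0r G0 subr0 => /eqP; rewrite subr_eq0 subr_eq => /eqP FG.
have -> : F b - F a = G b by rewrite FG; ring.
rewrite /G /Rintegral fineK; last exact: integrable_fin_num fi'.
by rewrite [RHS]integral_itv_bndoo//; case/integrableP : fi.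
Qed.
End FTC.

(** * One-sided derivatives and extension by constants *)

Section DeriveOn.
Context {R : realType}.
Implicit Types (A : set R) (f : R -> R).

(** Multiplying out the difference quotient removes the exceptional point
    [y = x]; in this form one-sided derivatives compose with a Lipschitz map. *)
Lemma derivable_on_approx A f x : derivable_on A f x ->
  forall eps : R, 0 < eps -> \forall y \near x,
    A y -> `|f y - f x - derive_on A f x * (y - x)| <= eps * `|y - x|.
Proof.
move=> /cvgrPdist_le df eps eps0.
have {df} := df _ eps0; rewrite -/(derive_on A f x).
rewrite !near_withinE; apply: filterS => y yx Ay.
have [->|yneqx] := eqVneq y x; first by rewrite !subrr mulr0 subrr !normr0 mulr0.
have := yx yneqx Ay; rewrite distrC.
have yx0 : y - x != 0 by rewrite subr_eq0.
have -> : f y - f x - derive_on A f x * (y - x) =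
  ((f y - f x) / (y - x) - derive_on A f x) * (y - x).
  by rewrite mulrBl divfK.
by rewrite normrM => h; rewrite ler_wpM2r.
Qed.

Lemma is_derive_approx f x d :
  (forall eps : R, 0 < eps ->
     \forall y \near x, `|f y - f x - d * (y - x)| <= eps * `|y - x|) ->
  is_derive x 1 f d.
Proof.
move=> H.
have C : h^-1 *: (f (h *: 1 + x) - f x) @[h --> 0^'] --> d.
  apply/cvgrPdist_le => eps eps0.
  rewrite near_withinE; have {H} := H _ eps0.
  rewrite (near_shift 0 x) => H; near=> h => h0.
  have : `|f (h + x) - f x - d * (h + x - x)| <= eps * `|h + x - x|.
    by near: h; move: H; apply: filterS => h /=; rewrite subr0.
  rewrite addrK => Hh; rewrite distrC.
  have -> : h^-1 *: (f (h *: 1 + x) - f x) - d =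
     (f (h + x) - f x - d * h) / h.
    by rewrite [h *: 1]mulr1 mulrBl mulfK// mulrC.
  by rewrite normrM normfV ler_pdivrMr ?normr_gt0.
by apply: DeriveDef; [exact: cvgP C|exact: cvg_lim C].
Unshelve. all: by end_near. Qed.

Lemma is_derive_derive_on A f x : A° x -> derivable_on A f x ->
  is_derive x 1 f (derive_on A f x).
Proof.
move=> Ax df; apply: is_derive_approx => eps eps0.
have := derivable_on_approx df eps0; have : \forall y \near x, A y by [].
by apply: filterS2 => y Ay; exact.
Qed.

Definition clamp (a b x : R) := Num.max a (Num.min x b).

Lemma clamp_itv a b x : a <= b -> a <= clamp a b x <= b.
Proof.
move=> ab; rewrite /clamp maxEle minEle.
by case: (leP x b) => ?; case: (leP a x) => ?; case: (leP a b) => ?; lra.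
Qed.

Lemma clamp_id a b x : a <= x <= b -> clamp a b x = x.
Proof.
move=> /andP[ax xb]; rewrite /clamp maxEle minEle.
by case: (leP x b) => ?; case: (leP a x) => ?; case: (leP a b) => ?; lra.
Qed.

Lemma clamp_lip a b x y : a <= b -> `|clamp a b x - clamp a b y| <= `|x - y|.
Proof.
move=> ab; rewrite /clamp !maxEle !minEle.
have := ler_norm (x - y); have := ler_norm (y - x); rewrite distrC => ? ?.
rewrite ler_norml; case: (leP x b) => ?; case: (leP y b) => ?;
  case: (leP a x) => ?; case: (leP a y) => ?; rewrite ?ab; try lra.
Qed.

Lemma clamp_continuous a b : a <= b -> continuous (clamp a b).
Proof.
move=> ab x; apply/cvgrPdist_le => eps eps0; near=> y.
apply: le_trans (clamp_lip _ _ ab) _; near: y.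
exact: (@cvgr_dist_le _ _ _ _ _ id x (@cvg_id _ _)).
Unshelve. all: by end_near. Qed.

Lemma near_clamp a b x (P : R -> Prop) : a <= b ->
  (\forall y \near clamp a b x, P y) -> \forall y \near x, P (clamp a b y).
Proof. by move=> ab wP; exact: (@clamp_continuous a b ab x P wP). Qed.

Lemma continuous_comp_clamp a b f : a <= b ->
  {within `[a, b], continuous f} -> continuous (f \o clamp a b).
Proof.
move=> ab /subspace_continuousP fc x.
have cx : clamp a b y @[y --> x] --> within `[a, b] (nbhs (clamp a b x)).
  move=> P wP.
  by apply: filterS (near_clamp ab wP) => y; apply; exact: clamp_itv.
exact: cvg_comp cx (fc _ (clamp_itv x ab)).
Qed.

(** At an end point the clamped function is constant on the outer side, so the
    two one-sided derivatives agree exactly because the inner one vanishes. *)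
Lemma is_derive_comp_clamp a b f : a < b ->
  (forall x, `[a, b]%classic x -> derivable_on `[a, b] f x) ->
  derive_on `[a, b] f a = 0 -> derive_on `[a, b] f b = 0 ->
  forall x : R, is_derive x 1 (f \o clamp a b) (derive_on `[a, b] f (clamp a b x)).
Proof.
move=> ab df fa fb x.
have flat : derive_on `[a, b] f (clamp a b x) = 0 ->
    is_derive x 1 (f \o clamp a b) (derive_on `[a, b] f (clamp a b x)).
  move=> f0; apply: is_derive_approx => eps eps0.
  have := derivable_on_approx (df _ (clamp_itv x (ltW ab))) eps0.
  move=> /(near_clamp (ltW ab)); apply: filterS => y.
  move=> /(_ (clamp_itv y (ltW ab))); rewrite f0 !mul0r => /le_trans; apply.
  by apply: ler_wpM2l; [exact: ltW|exact/clamp_lip/ltW].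
have [xa|ax] := leP x a.
  by apply: flat; rewrite /clamp min_l ?max_l//; lra.
have [bx|xb] := leP b x.
  by apply: flat; rewrite /clamp min_r// max_r//; lra.
rewrite clamp_id ?ltW//.
have xin : (`[a, b]%classic)° x.
  by rewrite interior_itv_bnd/=; rewrite in_itv/= ax xb.
have := is_derive_derive_on xin (df _ (interior_subset xin)).
apply: near_eq_is_derive; move: xin; apply: filterS => y yab.
by rewrite /= clamp_id.
Qed.

End DeriveOn.

(** * Twice differentiable functions with explicit derivatives *)

Section Jets.
Context {R : realType}.

(** The two derivatives are carried along as explicit total functions: products,
    compositions and bounds are then plain identities, without limits. *)
Record C2_jet (f f1 f2 : R -> R) : Prop := {
  jet_derive1 : forall x : R, is_derive x 1 f (f1 x);
  jet_derive2 : forall x : R, is_derive x 1 f1 (f2 x);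
  jet_cont2 : continuous f2
}.

Lemma is_derive_continuous (f : R -> R) (x d : R) :
  is_derive x 1 f d -> {for x, continuous f}.
Proof. by case=> df _; exact/differentiable_continuous/derivable1_diffP. Qed.

Lemma jet_cont1 f f1 f2 : C2_jet f f1 f2 -> continuous f1.
Proof. by case=> _ d2 _ x; exact: is_derive_continuous (d2 x). Qed.

Lemma jet_cont0 f f1 f2 : C2_jet f f1 f2 -> continuous f.
Proof. by case=> d1 _ _ x; exact: is_derive_continuous (d1 x). Qed.

Lemma C2_jet_comp g g1 g2 f f1 f2 : C2_jet g g1 g2 -> C2_jet f f1 f2 ->
  C2_jet (g \o f) (fun x => g1 (f x) * f1 x)
    (fun x => g2 (f x) * f1 x ^+ 2 + g1 (f x) * f2 x).
Proof.
move=> Jg Jf; have cf := jet_cont0 Jf; have cf1 := jet_cont1 Jf.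
have cg1 := jet_cont1 Jg.
case: Jg => dg dg1 cg2; case: Jf => df df1 cf2; split.
- move=> x; have := df x; have := dg (f x) => ? ?.
  by apply: is_derive_eq; rewrite mulrC.
- move=> x; have := df x; have := df1 x; have := dg1 (f x) => ? ? ?.
  have ? : is_derive x 1 (g1 \o f) (g2 (f x) * f1 x).
    exact: is_derive1_comp.
  apply: (@is_derive_eq _ _ _ ((g1 \o f) * f1)).
  by rewrite /= /GRing.scale/=; ring.
- move=> x; apply: cvgD; apply: cvgM.
  + exact: (continuous_comp (cf x) (cg2 (f x))).
  + by apply: cvgM; exact: cf1.
  + exact: (continuous_comp (cf x) (cg1 (f x))).
  + exact: cf2.
Qed.

Lemma C2_jet_affine k b : C2_jet (fun x => k * x + b) (fun=> k) (fun=> 0).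
Proof.
split => [x|x|x]; last exact: cvg_cst.
- have -> : (fun x => k * x + b) = k *: id + cst b by apply/funext => y.
  by apply: is_derive_eq; rewrite addr0 /GRing.scale/= mulr1.
- exact: is_derive_cst.
Qed.

Lemma C2_jetD f f1 f2 g g1 g2 : C2_jet f f1 f2 -> C2_jet g g1 g2 ->
  C2_jet (f \+ g) (f1 \+ g1) (f2 \+ g2).
Proof.
case=> df df1 cf2 [dg dg1 cg2]; split => x.
- by have := df x; have := dg x => ? ?; exact: is_deriveD.
- by have := df1 x; have := dg1 x => ? ?; exact: is_deriveD.
- by apply: cvgD; [exact: cf2|exact: cg2].
Qed.

Lemma continuous_bounded_itv (f : R -> R) (a b : R) : a <= b -> continuous f ->
  exists2 M : R, 0 <= M & forall x, a <= x <= b -> `|f x| <= M.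
Proof.
move=> ab cf; have cnf : {within `[a, b], continuous (fun x => `|f x|)}.
  apply: continuous_subspaceT => x; apply: cvg_comp (cf x) _.
  exact: norm_continuous.
have [c cab Hc] := EVT_max ab cnf.
by exists `|f c| => // x xab; apply: Hc; rewrite in_itv.
Qed.

Lemma C2_jet_expR : C2_jet (@expR R) expR expR.
Proof.
by split; [exact: is_derive_expR|exact: is_derive_expR|exact: continuous_expR].
Qed.

Lemma is_derive_cst_near (f : R -> R) x c :
  (\forall y \near x, f y = c) -> is_derive x 1 f 0.
Proof.
move=> fc; apply: (near_eq_is_derive (f := cst c)).
by apply: filterS fc => y ->.
Qed.

Lemma is_derive_unique (f g : R -> R) (x d1 d2 : R) :
  (\forall y \near x, f y = g y) -> is_derive x 1 f d1 -> is_derive x 1 g d2 ->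
  d1 = d2.
Proof. by move=> fg /(near_eq_is_derive fg)[_ <-] [_ <-]. Qed.

(** A test function agrees with a jet on an edge only; since derivatives are
    local this suffices inside the edge. *)
Lemma jet_eq_oo (f P P1 P2 : R -> R) a b : C2_jet P P1 P2 ->
  (forall t, a < t < b -> f t = P t) ->
  forall t, a < t < b -> derive1n 2 f t = P2 t.
Proof.
move=> [d1 d2 _] fP t tab.
have nab (s : R) : a < s < b -> \forall z \near s, a < z < b.
  move=> /andP[as_ sb]; near=> z; apply/andP; split; near: z.
    exact: lt_nbhsr.
  exact: lt_nbhsl.
have D1 s : a < s < b -> derive1 f s = P1 s.
  move=> sab; rewrite derive1E (near_eq_derive (g := P)).
    by case: (d1 s).
  by apply: filterS (nab _ sab) => z /fP.
rewrite /derive1n /= derive1E (near_eq_derive (g := P1)).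
  by case: (d2 t).
by apply: filterS (nab _ tab) => z /D1.
Unshelve. all: by end_near. Qed.

End Jets.

(** * Extension of the two profiles *)

Section Extensions.
Context {R : realType}.

(** A transition profile on the whole line, flat outside [0, 1]; flatness is
    what allows rescaled copies of it to be added without gluing. *)
Record smooth_step (C : R) (e0 e1 e2 : R -> R) : Prop := {
  step_jet : C2_jet e0 e1 e2;
  step_range : forall x : R, 0 <= e0 x <= 1;
  step_left : forall x : R, x <= 0 -> e0 x = 0 /\ e1 x = 0;
  step_right : forall x : R, 1 <= x -> e0 x = 1 /\ e1 x = 0;
  step_bound : forall x : R, `|e1 x| <= C /\ `|e2 x| <= C
}.

(** The first two derivatives of [eta] vanish at both ends of [0, 1], so both
    [eta] and its derivative can be continued by constants. *)
Lemma eta_extension (eta : R -> R) : is_eta eta ->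
  exists C e0 e1 e2, smooth_step C e0 e1 e2 /\
    forall x : R, 0 <= x <= 1 -> e0 x = eta x.
Proof.
move=> H; have [_ [deta [_ [deta1 [ceta2 _]]]]] := eta_C3 H.
have [C HC] := eta_bounded H.
pose D f := derive_on `[(0 : R), 1] f.
exists C, (eta \o clamp 0 1), (D eta \o clamp 0 1), (D (D eta) \o clamp 0 1).
split; last by move=> x x01; rewrite /= clamp_id.
have lo x : x <= 0 -> clamp 0 1 x = 0 :> R.
  by move=> x0; rewrite /clamp min_l ?max_l//; lra.
have hi x : 1 <= x -> clamp 0 1 x = 1 :> R.
  by move=> x0; rewrite /clamp min_r// max_r//; lra.
split.
- split.
  + exact: (is_derive_comp_clamp ltr01 deta (eta_d1_0 H) (eta_d1_1 H)).
  + exact: (is_derive_comp_clamp ltr01 deta1 (eta_d2_0 H) (eta_d2_1 H)).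
  + exact: continuous_comp_clamp.
- by move=> x; exact: (eta_range H (clamp_itv x ler01)).
- by move=> x /lo /= ->; rewrite (eta_0 H) /D (eta_d1_0 H).
- by move=> x /hi /= ->; rewrite (eta_1 H) /D (eta_d1_1 H).
- by move=> x; exact: (HC _ (clamp_itv x ler01)).
Qed.

Lemma smooth_step_bound_ge0 C e0 e1 e2 : smooth_step C e0 e1 e2 -> 0 <= C.
Proof. by move=> H; apply: le_trans (normr_ge0 _) (step_bound H 0).1. Qed.

(** [psi] is identically 1 up to 1, so continuing it by 1 to the left keeps it
    twice continuously differentiable and removes the end point [a]. The
    exponential bounds hold to the left of 0 because the exponential is at least
    1 there, on [0, 3] by compactness, and beyond by the explicit formula. *)
Lemma psi_extension (a delta : R) (psi : R -> R) : 0 < delta -> a <= 0 ->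
  is_psi a delta psi ->
  exists C p0 p1 p2, [/\ C2_jet p0 p1 p2,
    forall t, a <= t -> p0 t = psi t,
    forall t, 0 <= p0 t &
    forall t, [/\ `|p0 t| <= C * expR (- (delta * t)),
     `|p1 t| <= C * expR (- (delta * t)) & `|p2 t| <= C * expR (- (delta * t))]].
Proof.
move=> d0 a0 H; have [_ [dpsi [_ [dpsi1 [cpsi2 _]]]]] := psi_C2 H.
pose D f := derive_on `[a, +oo[ f.
(* any threshold strictly between 0 and 1 lies where psi is locally constant *)
pose h : R := 2^-1.
pose p0 x := if x <= h then 1 else psi x.
pose p1 x := if x <= h then 0 else D psi x.
pose p2 x := if x <= h then 0 else D (D psi) x.
have h0 : 0 < h by rewrite /h; lra.
have h1 : h < 1 by rewrite /h; lra.
have inside x : h < x -> (`[a, +oo[%classic)° x.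
  move=> hx; apply: filterS (lt_nbhsr hx) => y hy.
  by rewrite /= in_itv/= andbT; lra.
have ngt (x : R) : h < x -> \forall y \near x, h < y by exact: lt_nbhsr.
have nlt (x : R) : x < 1 -> \forall y \near x, y < 1 by exact: lt_nbhsl.
have dp x : h < x -> is_derive x 1 psi (D psi x).
  move=> hx; have ix := inside _ hx.
  exact: is_derive_derive_on ix (dpsi _ (interior_subset ix)).
have dp1 x : h < x -> is_derive x 1 (D psi) (D (D psi) x).
  move=> hx; have ix := inside _ hx.
  exact: is_derive_derive_on ix (dpsi1 _ (interior_subset ix)).
have p0_1 x : x < 1 -> p0 x = 1.
  move=> x1; rewrite /p0; case: ifPn => //; rewrite -ltNge => hx.
  by apply: (psi_1 H); apply/andP; split; lra.
have p1_0 x : x < 1 -> p1 x = 0.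
  move=> x1; rewrite /p1; case: ifPn => //; rewrite -ltNge => hx.
  apply: (@is_derive_unique R psi (cst 1) x _ 0 _ (dp _ hx) (is_derive_cst _ _ _)).
  near=> y; rewrite /cst -(p0_1 y); last by near: y; exact: nlt.
  rewrite /p0 leNgt.
  have -> : h < y by near: y; exact: ngt.
  by [].
have p2_0 x : x < 1 -> p2 x = 0.
  move=> x1; rewrite /p2; case: ifPn => //; rewrite -ltNge => hx.
  apply: (@is_derive_unique R (D psi) (cst 0) x _ 0 _ (dp1 _ hx) (is_derive_cst _ _ _)).
  near=> y; rewrite /cst -(p1_0 y); last by near: y; exact: nlt.
  rewrite /p1 leNgt.
  have -> : h < y by near: y; exact: ngt.
  by [].
have p0E x : h < x -> p0 x = psi x by move=> hx; rewrite /p0 leNgt hx.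
have p1E x : h < x -> p1 x = D psi x by move=> hx; rewrite /p1 leNgt hx.
have p2E x : h < x -> p2 x = D (D psi) x by move=> hx; rewrite /p2 leNgt hx.
have cp2 (x : R) : {for x, continuous p2}.
  have [x1|x1] := ltP x 1.
    apply: is_derive_continuous (@is_derive_cst_near R p2 x 0 _).
    by apply: filterS (nlt _ x1) => y /p2_0.
  rewrite /prop_for /continuous_at.
  have hx : h < x by lra.
  rewrite p2E//.
  have := (subspace_continuousP _ _).1 cpsi2 _ (interior_subset (inside _ hx)).
  rewrite within_interior; last exact: inside.
  apply: cvg_trans; apply: near_eq_cvg.
  by apply: filterS (ngt _ hx) => y /p2E.
have J : C2_jet p0 p1 p2.
  split=> x; last (by exact: cp2); have [x1|x1] := ltP x 1.
  - rewrite p1_0//; apply: (@is_derive_cst_near R _ _ 1).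
    by apply: filterS (nlt _ x1) => y; exact: p0_1.
  - have hx : h < x by lra.
    rewrite p1E//; apply: near_eq_is_derive (dp _ hx).
    by apply: filterS (ngt _ hx) => y /p0E.
  - rewrite p2_0//; apply: (@is_derive_cst_near R _ _ 0).
    by apply: filterS (nlt _ x1) => y; exact: p1_0.
  - have hx : h < x by lra.
    rewrite p2E//; apply: near_eq_is_derive (dp1 _ hx).
    by apply: filterS (ngt _ hx) => y /p1E.
have tail (x : R) : 2 < x -> [/\ p0 x = expR (- (delta * x)),
    p1 x = - delta * expR (- (delta * x)) &
    p2 x = delta ^+ 2 * expR (- (delta * x))].
  have [dE dE1 _] := C2_jet_comp C2_jet_expR (C2_jet_affine (- delta) 0).
  have n2 (y : R) : 2 < y -> \forall z \near y, 2 < z by exact: lt_nbhsr.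
  have t0 y : 2 < y -> p0 y = expR (- delta * y + 0).
    by move=> y2; rewrite p0E ?(psi_exp H) ?mulNr ?addr0//; lra.
  have t1 y : 2 < y -> p1 y = expR (- delta * y + 0) * - delta.
    move=> y2; apply: (is_derive_unique _ (jet_derive1 J y) (dE y)).
    by apply: filterS (n2 _ y2) => z /t0.
  have t2 y : 2 < y -> p2 y =
      expR (- delta * y + 0) * (- delta) ^+ 2 + expR (- delta * y + 0) * 0.
    move=> y2; apply: (is_derive_unique _ (jet_derive2 J y) (dE1 y)).
    by apply: filterS (n2 _ y2) => z /t1.
  move=> x2; rewrite t0// t1// t2// addr0 mulNr sqrrN mulr0 addr0.
  by split=> //; rewrite mulrC.
(* psi is exponential on a neighbourhood of t only if 2 < t, hence the bound 3 *)
have [M0 M00 B0] := continuous_bounded_itv (ler0n R 3) (jet_cont0 J).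
have [M1 M10 B1] := continuous_bounded_itv (ler0n R 3) (jet_cont1 J).
have [M2 M20 B2] := continuous_bounded_itv (ler0n R 3) (jet_cont2 J).
pose C := 1 + delta + delta ^+ 2 + (M0 + M1 + M2) * expR (delta * 3).
exists C, p0, p1, p2; split => //.
- move=> t at_; have [th|th] := ltP t 1; last by rewrite p0E//; lra.
  by rewrite p0_1// (psi_1 H)//; apply/andP; split => //; exact: ltW.
- move=> t; have [th|th] := ltP t 1; first by rewrite p0_1.
  by rewrite p0E; [apply/ltW/(psi_gt0 H)|]; lra.
move=> t; have e0 := expR_gt0 (- (delta * t)); have E3 := expR_gt0 (delta * 3).
have d2 : 0 <= delta ^+ 2 by exact: sqr_ge0.
have [t0|t0] := ltP t 0.
  have e1 : 1 <= expR (- (delta * t)) by rewrite -expR0 ler_expR; nra.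
  have C1 : 1 <= C by rewrite /C; nra.
  have Ce1 : 1 <= C * expR (- (delta * t)) by nra.
  have t1 : t < 1 by exact: lt_trans ltr01.
  rewrite p0_1// p1_0// p2_0// normr0 normr1.
  by split=> //; exact: le_trans Ce1.
have [t3|t3] := leP t 3.
  have e3 : 1 <= expR (delta * 3) * expR (- (delta * t)).
    by rewrite -expRD -[leLHS]expR0 ler_expR -mulrBr mulr_ge0 ?subr_ge0// ltW.
  have Ci (M : R) : 0 <= M -> M <= M0 + M1 + M2 -> M <= C * expR (- (delta * t)).
    move=> M0' MM.
    apply: (@le_trans _ _
      ((M0 + M1 + M2) * (expR (delta * 3) * expR (- (delta * t))))).
      by nra.
    rewrite mulrA; apply: ler_wpM2r; first exact: ltW.
    by rewrite /C lerDr; lra.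
  have t03 : 0 <= t <= 3 by apply/andP.
  split; [apply: le_trans (B0 _ t03) _|apply: le_trans (B1 _ t03) _
         |apply: le_trans (B2 _ t03) _]; apply: Ci => //; lra.
have [|-> -> ->] := tail t; first lra.
have [C1 [C2 C3]] : 1 <= C /\ (delta <= C /\ delta ^+ 2 <= C).
  by rewrite /C; split; [|split]; nra.
rewrite !(normrM _ (expR _)) normrN (gtr0_norm e0) (gtr0_norm d0) (ger0_norm d2).
by split; [rewrite -[leLHS]mul1r| |]; apply: ler_wpM2r => //; exact: ltW.
Unshelve. all: by end_near. Qed.

End Extensions.

(** * The distance along an edge *)

Section Distance.
Context {R : realType} (G : metric_graph R).
Implicit Types (e : edge G) (s t : R) (x y : gpoint G).

Lemma ept0 e : ept e 0 = vpt (ini e).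
Proof. by rewrite /ept; case: insubP => [p /=|_]; rewrite ?ltxx// lexx. Qed.

Lemma ept_len e : ept e (len e) = vpt (fin e).
Proof.
rewrite /ept; case: insubP => [p /=|_]; first by rewrite ltxx andbF.
by rewrite leNgt len_gt0.
Qed.

Lemma ept_inner e t : 0 < t < len e ->
  exists2 p : {p : edge G * R | 0 < p.2 < len p.1}, ept e t = inr p & val p = (e, t).
Proof.
move=> te; rewrite /ept; case: insubP => [p _ pE|]; first by exists p.
by rewrite te.
Qed.

Lemma ept_inj e e' s t : 0 < t < len e -> ept e' s = ept e t -> e' = e /\ s = t.
Proof.
move=> /ept_inner[p -> pE]; rewrite /ept; case: insubP => // q _ qE [qp].
by move: qE; rewrite qp pE => -[-> ->].
Qed.

Lemma gpath_ge0 x y L : gpath x y L -> 0 <= L.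
Proof. by elim=> // *; rewrite addr_ge0. Qed.

Lemma dist_le x y L : gpath x y L -> dist x y <= L.
Proof.
move=> p; apply: ge_inf => //; exists 0 => L' /=; exact: gpath_ge0.
Qed.

Hypothesis conn : connected_graph G.

Lemma le_dist x y a : (forall L, gpath x y L -> a <= L) -> a <= dist x y.
Proof. by move=> H; apply: lb_le_inf => //; exact: conn. Qed.

Lemma dist_ge0 x y : 0 <= dist x y.
Proof. by apply: le_dist => L; exact: gpath_ge0. Qed.

(** A path starting at [t] is prolonged by the segment from [s] to [t]. *)
Lemma dist_step e s t y : 0 <= s <= len e -> 0 <= t <= len e ->
  dist (ept e s) y <= `|s - t| + dist (ept e t) y.
Proof.
move=> hs ht; rewrite -lerBlDl; apply: le_dist => L p.
by rewrite lerBlDl; apply: dist_le; exact: gpath_cons.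
Qed.

(** A path that starts inside an edge must leave it through one of its end
    points. By induction on the path: a first segment that stays inside the same
    edge changes the right-hand side by at most its length, and from an end
    point on the bound is the definition of the distance. *)
Lemma gpath_edge x y L (v : vertex G) e t : gpath x y L ->
  y = vpt v -> 0 <= t <= len e -> x = ept e t ->
  Num.min (dist (vpt (ini e)) (vpt v) + t)
    (dist (vpt (fin e)) (vpt v) + len e - t) <= L.
Proof.
move=> p; elim: p e t => {x y L} [x|e' s s' y L hs hs' p IH] e t yv te xe.
  have xv : gpath (ept e t) (vpt v) 0 by rewrite -xe -yv; exact: gpath_nil.
  case: (eqVneq t 0) xv => [->|t0] xv.
    by rewrite ge_min addr0 -ept0 (dist_le xv).
  case: (eqVneq t (len e)) xv => [->|tl] xv.
    by rewrite ge_min addrK -ept_len (dist_le xv) orbT.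
  have /ept_inner[q qE _] : 0 < t < len e by rewrite !lt_neqAle eq_sym t0 tl.
  by move: xe; rewrite yv qE.
have p' := gpath_cons hs hs' p.
case: (eqVneq t 0) xe => [->|t0] xe.
  by rewrite ge_min addr0 -ept0 -xe -yv (dist_le p').
case: (eqVneq t (len e)) xe => [->|tl] xe.
  by rewrite ge_min addrK -ept_len -xe -yv (dist_le p') orbT.
have te' : 0 < t < len e by rewrite !lt_neqAle eq_sym t0 tl.
have [ee st] := ept_inj te' xe; subst e' s.
apply: (@le_trans _ _ (`|t - s'| +
    Num.min (dist (vpt (ini e)) (vpt v) + s')
      (dist (vpt (fin e)) (vpt v) + len e - s'))).
  have := ler_norm (t - s'); have := ler_norm (s' - t); rewrite distrC => n1 n2.
  case: (leP (dist (vpt (ini e)) (vpt v) + s')) => _; rewrite ge_min.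
    by apply/orP; left; lra.
  by apply/orP; right; lra.
by rewrite lerD2l IH.
Qed.

Lemma dist_edge e t (v : vertex G) : 0 <= t <= len e ->
  dist (ept e t) (vpt v) =
  Num.min (dist (vpt (ini e)) (vpt v) + t)
    (dist (vpt (fin e)) (vpt v) + len e - t).
Proof.
move=> te; have e0 := len_gt0 e.
have te0 : 0 <= (0 : R) <= len e by rewrite lexx/= ltW.
have tee : 0 <= len e <= len e by rewrite lexx andbT ltW.
apply/eqP; rewrite eq_le; apply/andP; split.
  rewrite le_min -ept0 -ept_len; apply/andP; split.
    have := dist_step (vpt v) te te0; rewrite subr0 ger0_norm; lra.
  have := dist_step (vpt v) te tee; rewrite distrC ger0_norm; lra.
by apply: le_dist => L p; exact: gpath_edge p (erefl _) te (erefl _).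
Qed.
End Distance.

(** * The modified distance along an edge *)

Section TwoSteps.
Context {R : realType} (C : R) (e0 e1 e2 : R -> R).
Hypothesis H : smooth_step C e0 e1 e2.

(** The modified distance along an edge has this form: the first step carries it
    from the initial vertex to the break point and the second one, of opposite
    sign, from there to the final vertex; without a break point [d = 0]. As each
    step is constant while the other one varies, no gluing at the middle of the
    edge is needed. *)
Definition two_steps A c d k b (t : R) : R :=
  A + c * e0 (k * t) + d * e0 (k * t - b).

Definition two_steps1 c d k b (t : R) : R :=
  c * k * e1 (k * t) + d * k * e1 (k * t - b).

Definition two_steps2 c d k b (t : R) : R :=
  c * k ^+ 2 * e2 (k * t) + d * k ^+ 2 * e2 (k * t - b).

Lemma two_steps_jet A c d k b :
  C2_jet (two_steps A c d k b) (two_steps1 c d k b) (two_steps2 c d k b).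
Proof.
have J := step_jet H.
have Jc := C2_jet_comp (C2_jet_affine c A) (C2_jet_comp J (C2_jet_affine k 0)).
have Jd := C2_jet_comp (C2_jet_affine d 0) (C2_jet_comp J (C2_jet_affine k (- b))).
have := C2_jetD Jc Jd.
congr C2_jet; apply/funext => t;
  by rewrite /two_steps /two_steps1 /two_steps2 /= !addr0; ring.
Qed.

Lemma two_steps_bound c d k b j m t : `|c| <= j -> `|d| <= j -> `|k| <= m ->
  `|two_steps1 c d k b t| <= 2 * j * m * C /\
  `|two_steps2 c d k b t| <= 2 * j * m ^+ 2 * C.
Proof.
move=> cj dj km; have [B1 B2] := step_bound H (k * t).
have [B1' B2'] := step_bound H (k * t - b).
have T (x l z n : R) : `|x| <= j -> `|l| <= n -> `|z| <= C ->
    `|x * l * z| <= j * n * C.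
  move=> xj ln zC; rewrite !normrM.
  by do 2 (apply: ler_pM => //; rewrite ?mulr_ge0//).
have k2m : `|k ^+ 2| <= m ^+ 2.
  by rewrite normrX lerXn2r// nnegrE// (le_trans _ km).
split; apply: le_trans (ler_normD _ _) _.
  by have := T _ _ _ _ cj km B1; have := T _ _ _ _ dj km B1'; lra.
by have := T _ _ _ _ cj k2m B2; have := T _ _ _ _ dj k2m B2'; lra.
Qed.

End TwoSteps.

Section ModifiedDistance.
Context {R : realType} (G : metric_graph R).
Implicit Types (e : edge G) (s t : R).
Hypothesis conn : connected_graph G.
Variables (j r : R).
Hypotheses (r0 : 0 < r) (len_ge : forall e, r <= len e).
Hypothesis len_le : forall e, len e <= j.
Variables (x0 : vertex G) (eta : R -> R).
Hypothesis eta_ok : is_eta eta.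

Local Notation d x := (dist x (vpt x0)).

Lemma mod_coord_range e t : 0 <= t <= len e ->
  0 <= mod_coord eta (vpt x0) e t <= len e.
Proof.
move=> te; have e0 := len_gt0 e; rewrite /mod_coord.
have rng a b (x : R) : 0 <= a -> 0 <= x <= 1 -> a + b <= len e -> 0 <= b ->
    0 <= a * eta x + b <= len e.
  by move=> a0 x01 abl b0; have := eta_range eta_ok x01; nra.
case: ifPn => [/asboolP brk|_].
  have [q0 _ _] := xgetPex 0 brk; set q := xget _ _ in q0 *.
  case: (leP t (len e / 2)) => h.
    rewrite -[_ * eta _]addr0; apply: rng; try lra.
    by rewrite ler_pdivrMr// ler_pdivlMr//; lra.
  apply: rng; try lra.
  by rewrite ler_pdivrMr// ler_pdivlMr//; lra.
rewrite -[_ * eta _]addr0; apply: rng; try lra.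
by rewrite ler_pdivrMr// ler_pdivlMr//; lra.
Qed.

Lemma mod_dist_ept e t : 0 <= t <= len e ->
  mod_dist eta (vpt x0) (ept e t) = d (ept e (mod_coord eta (vpt x0) e t)).
Proof.
move=> te; have e0 := len_gt0 e; have eN0 : len e != 0 by rewrite gt_eqF.
have [->|t0] := eqVneq t 0.
  rewrite [in LHS]ept0 /= -ept0; congr (d (ept e _)).
  rewrite /mod_coord mulr0 mul0r (eta_0 eta_ok) !mulr0.
  by case: ifP => // _; rewrite ifT//; lra.
have [->|tl] := eqVneq t (len e).
  rewrite [in LHS]ept_len /= -ept_len; congr (d (ept e _)); rewrite /mod_coord divff//.
  have -> : 2 * len e - len e = len e by lra.
  rewrite divff// (eta_1 eta_ok) !mulr1 subrK; case: ifP => // _.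
  by rewrite ifF//; apply/negbTE; rewrite -ltNge; lra.
have /ept_inner[p -> pE] : 0 < t < len e by rewrite !lt_neqAle eq_sym t0 tl.
by rewrite /= pE.
Qed.

Lemma mod_dist_near e t : 0 <= t <= len e ->
  `|mod_dist eta (vpt x0) (ept e t) - d (ept e t)| <= j.
Proof.
move=> te; rewrite mod_dist_ept//; have ce := mod_coord_range te.
have h1 := dist_step conn (vpt x0) te ce; have h2 := dist_step conn (vpt x0) ce te.
have lj := len_le e.
have tc : `|t - mod_coord eta (vpt x0) e t| <= j by rewrite ler_norml; lra.
by rewrite ler_norml; move: h2; rewrite distrC => h2; lra.
Qed.

(** By [dist_edge] the distance to [x0] along an edge increases, or decreases, or
    has a break point at which the two branches have the same value; the three
    cases give one or two steps, with derivatives bounded in terms of the extreme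
    edge lengths only. *)
Lemma mod_dist_two_steps C (p0 p1 p2 : R -> R) e : smooth_step C p0 p1 p2 ->
  (forall x, 0 <= x <= 1 -> p0 x = eta x) ->
  exists A c b k q, [/\ `|c| <= j, `|b| <= j, `|k| <= 2 / r,
    (forall t, 0 <= t <= len e ->
       mod_dist eta (vpt x0) (ept e t) = two_steps p0 A c b k q t) &
    two_steps1 p1 c b k q 0 = 0 /\ two_steps1 p1 c b k q (len e) = 0].
Proof.
move=> H p0E; have l0 := len_gt0 e; have lj := len_le e; have lr := len_ge e.
have lN0 : len e != 0 by rewrite gt_eqF.
have kr (c : R) : 0 <= c -> c <= 2 -> `|c / len e| <= 2 / r.
  move=> c0 c2; rewrite ger0_norm ?divr_ge0//; try lra.
  by apply: ler_pM; rewrite ?invr_ge0; try lra; rewrite lef_pV2.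
have k2 : `|2 / len e| <= 2 / r by rewrite kr.
have k1 : `|1 / len e| <= 2 / r by rewrite kr// ler1n.
case: (pselect (exists q, is_break (vpt x0) e q)) => brk.
  have [q0 dq1 dq2] := xgetPex 0 brk; set q := xget _ _ in q0 dq1 dq2.
  exists (d (vpt (ini e))), q, (- (len e - q)), (2 / len e), 1.
  split; rewrite ?k2//; try by rewrite ler_norml; lra.
    move=> t te; rewrite mod_dist_ept// /mod_coord.
    have -> : `[< exists q, is_break (vpt x0) e q >] by apply/asboolP.
    rewrite -/q /two_steps (mulrAC 2 (len e)^-1 t); case: (leP t (len e / 2)) => h.
      have h01 : 0 <= 2 * t / len e <= 1 by rewrite ler_pdivrMr// ler_pdivlMr//; lra.
      rewrite p0E// (step_left H _).1 ?mulr0 ?addr0; last lra.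
      by rewrite dq1//; have := eta_range eta_ok h01; nra.
    have h1 : 1 <= 2 * t / len e by rewrite ler_pdivlMr//; lra.
    rewrite (step_right H h1).1.
    have -> : 2 * t / len e - 1 = (2 * t - len e) / len e by rewrite mulrBl divff.
    have h01 : 0 <= (2 * t - len e) / len e <= 1.
      by rewrite ler_pdivrMr// ler_pdivlMr//; lra.
    have := eta_range eta_ok h01; rewrite p0E// => rg.
    have := dq1 q; have := dq2 q; rewrite lexx => -> ; last lra.
    move=> E; rewrite dq2; last by nra.
    have := E; rewrite andbT => /(_ (ltW (andP q0).1)) E'; lra.
  rewrite /two_steps1 !mulr0 sub0r mulfVK// (step_left H (lexx 0)).2.
  rewrite (step_left H _).2 ?oppr_le0// (step_right H _).2 ?ler1n//.
  by rewrite (_ : 2 - 1 = 1) ?(step_right H (lexx 1)).2 ?mulr0 ?addr0//; lra.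
(* where both branches of the minimum agree there is a break point *)
have nb q : 0 < q < len e ->
    d (vpt (ini e)) + q = d (vpt (fin e)) + len e - q -> False.
  move=> qe E; apply: brk; exists q.
  split => // t tq; rewrite (dist_edge conn); try lra.
    by rewrite min_l; lra.
  by rewrite min_r; lra.
set a := d (vpt (ini e)) in nb *; set b := d (vpt (fin e)) in nb *.
have mc t : mod_coord eta (vpt x0) e t = len e * eta (t / len e).
  by rewrite /mod_coord ifN//; apply/asboolPn.
have dl (c : R) : two_steps1 p1 c 0 (1 / len e) 0 0 = 0 /\
    two_steps1 p1 c 0 (1 / len e) 0 (len e) = 0.
  rewrite /two_steps1 !mul0r !addr0 mulr0 mulfVK// (step_left H (lexx 0)).2.
  by rewrite (step_right H (lexx 1)).2 mulr0.
have t01 t : 0 <= t <= len e -> 0 <= t / len e <= 1.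
  by move=> te; rewrite ler_pdivrMr// ler_pdivlMr//; lra.
have tE t : 1 / len e * t = t / len e by rewrite mul1r mulrC.
have rg t : 0 <= t <= len e -> 0 <= len e * eta (t / len e) <= len e.
  by move=> te; rewrite -mc mod_coord_range.
case: (leP (len e) (b - a)) => ba.
  exists a, (len e), 0, (1 / len e), 0.
  split; rewrite ?normr0 ?k1 ?ler_norml //; try lra.
  move=> t te; rewrite mod_dist_ept// mc (dist_edge conn)//; last first.
    by rewrite -mc mod_coord_range.
  rewrite /two_steps mul0r addr0 tE p0E ?t01// -/a -/b.
  by have := rg _ te => ?; rewrite min_l; lra.
case: (leP (len e) (a - b)) => ab.
  exists (b + len e), (- len e), 0, (1 / len e), 0.
  split; rewrite ?normr0 ?k1 ?ler_norml //; try lra.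
  move=> t te; rewrite mod_dist_ept// mc (dist_edge conn)//; last first.
    by rewrite -mc mod_coord_range.
  rewrite /two_steps mul0r addr0 tE p0E ?t01// -/a -/b.
  by have := rg _ te => ?; rewrite min_r; lra.
by case: (nb ((b + len e - a) / 2)); lra.
Qed.

End ModifiedDistance.

(** * Decay of the test function *)

Section TestFunction.
Context {R : realType} (G : metric_graph R).
Implicit Types (e : edge G) (s t : R).
Hypothesis conn : connected_graph G.
Variables (j r : R).
Hypotheses (r0 : 0 < r) (len_ge : forall e, r <= len e).
Hypotheses (len_le : forall e, len e <= j) (j0 : 0 <= j).
Variables (x0 : vertex G) (eta : R -> R).
Hypothesis eta_ok : is_eta eta.
Variables (delta rho : R) (psi : R -> R).
Hypotheses (delta0 : 0 < delta) (rho1 : 1 <= rho).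
Hypothesis psi_ok : is_psi (- (max_len G / rho)) delta psi.
Hypothesis jE : max_len G = j.

Local Notation d x := (dist x (vpt x0)).
Local Notation alpha := (delta / rho).
Local Notation Psi := (test_fun eta psi (vpt x0) rho).

(** The modified distance differs from the distance by at most [j], a bounded
    factor after exponentiation, and its first two derivatives along the edges
    are bounded uniformly in the edge; the chain rule does the rest. The first
    derivative vanishes at the vertices because that of a step does. *)
Lemma test_fun_jets : exists2 K, 0 <= K &
  (forall v, 0 <= Psi (vpt v) <= K * expR (- (alpha * d (vpt v)))) /\
  forall e, exists P P1 P2, [/\ C2_jet P P1 P2,
    forall t, 0 <= t <= len e -> Psi (ept e t) = P t,
    P1 0 = 0 /\ P1 (len e) = 0 &
    forall t, 0 <= t <= len e ->
      0 <= P t <= K * expR (- (alpha * d (ept e t))) /\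
      `|P2 t| <= K * expR (- (alpha * d (ept e t)))].
Proof.
have rho0 : 0 < rho by exact: lt_le_trans ltr01 rho1.
have a0 : - (max_len G / rho) <= 0 by rewrite oppr_le0 jE divr_ge0// ltW.
have [Cp [p0 [p1 [p2 [Jp p0E p0ge pB]]]]] := psi_extension delta0 a0 psi_ok.
have [C [e0 [e1 [e2 [He e0E]]]]] := eta_extension eta_ok.
have C0 := smooth_step_bound_ge0 He.
have Cp0 : 0 <= Cp.
  have [+ _ _] := pB 0; rewrite mulr0 oppr0 expR0 mulr1.
  exact: le_trans (normr_ge0 _).
pose B1 := 2 * j * (2 / r) * C; pose B2 := 2 * j * (2 / r) ^+ 2 * C.
have r20 : 0 <= 2 / r by rewrite divr_ge0 ?ltW.
have j20 : 0 <= 2 * j by rewrite mulr_ge0.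
have B10 : 0 <= B1 := mulr_ge0 (mulr_ge0 j20 r20) C0.
have B20 : 0 <= B2 := mulr_ge0 (mulr_ge0 j20 (exprn_ge0 2 r20)) C0.
pose K0 := Cp * expR (2 * alpha * j).
have K00 : 0 <= K0 by rewrite mulr_ge0 ?expR_ge0.
have al0 : 0 < alpha by rewrite divr_gt0.
(* the factor 2 j: one j from the shift in the argument of psi, one from
   comparing the modified distance with the distance *)
have decay D d0 : `|D - d0| <= j ->
    Cp * expR (- (delta * ((D - j) / rho))) <= K0 * expR (- (alpha * d0)).
  move=> Dd; rewrite /K0 -mulrA ler_wpM2l// -expRD ler_expR.
  have -> : delta * ((D - j) / rho) = alpha * (D - j) by rewrite mulrCA mulrC.
  have : alpha * (d0 - 2 * j) <= alpha * (D - j).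
    by rewrite ler_pM2l//; move: Dd; rewrite ler_norml; lra.
  by lra.
have psiE D : 0 <= D -> psi ((D - max_len G) / rho) = p0 ((D - j) / rho).
  by move=> D0; rewrite jE p0E// jE -mulNr ler_pM2r ?invr_gt0//; lra.
pose K := K0 * (1 + B1 ^+ 2 + B2).
have B12 : 0 <= B1 ^+ 2 by rewrite exprn_ge0.
have K0K : K0 <= K by rewrite /K ler_peMr//; lra.
have wK (x : gpoint G) : K0 * expR (- (alpha * d x)) <= K * expR (- (alpha * d x)).
  by rewrite ler_wpM2r ?expR_ge0.
exists K; first exact: le_trans K0K.
split=> [v|e].
  rewrite /test_fun /= psiE ?dist_ge0// p0ge/=.
  apply: le_trans (wK _); apply: le_trans (decay (d (vpt v)) _ _); last first.
    by rewrite subrr normr0.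
  by have [+ _ _] := pB ((d (vpt v) - j) / rho); apply: le_trans; exact: ler_norm.
have [A [c [b [k [q [cj bj kr DE [D10 D1l]]]]]]] :=
  mod_dist_two_steps conn r0 len_ge len_le x0 eta_ok e He e0E.
set D := two_steps _ _ _ _ _ _ in DE; set D1 := two_steps1 e1 c b k q in D10 D1l.
pose D2 := two_steps2 e2 c b k q.
have JD : C2_jet D D1 D2 := two_steps_jet He A c b k q.
have DB t : `|D1 t| <= B1 /\ `|D2 t| <= B2 := two_steps_bound He q t cj bj kr.
have := C2_jet_comp Jp (C2_jet_comp (C2_jet_affine rho^-1 (- (j / rho))) JD).
set P := _ \o _; set P1 := fun _ => _; set P2 := fun _ => _ => JP.
have sE t : rho^-1 * D t - j / rho = (D t - j) / rho by rewrite mulrBl mulrC.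
exists P, P1, P2; split => //.
- move=> t te; rewrite /test_fun psiE DE// ?/P /= ?sE// -DE//.
  by rewrite (mod_dist_ept x0 eta_ok te) dist_ge0.
- by rewrite /P1 D10 D1l !mulr0.
move=> t te.
have near : `|D t - d (ept e t)| <= j.
  by rewrite -DE// (mod_dist_near conn len_le x0 eta_ok te).
have := decay _ _ near; set w := K0 * _ => dec.
have [b0 b1 b2] := pB ((D t - j) / rho).
have w0 : 0 <= w by rewrite mulr_ge0 ?expR_ge0.
rewrite /P /P2 /= sE p0ge/=; split.
  by apply: le_trans (wK _); apply: le_trans dec; apply: le_trans b0; exact: ler_norm.
have [d1 d2] := DB t.
have ri : 0 <= rho^-1 <= 1 by rewrite invr_ge0 ltW//= invf_le1.
have rD (x B : R) : `|x| <= B -> `|rho^-1 * x| <= B.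
  by move=> xB; rewrite normrM ger0_norm ?(andP ri).1//; have := normr_ge0 x; nra.
rewrite mul0r add0r /K mulrAC -/w.
apply: le_trans (ler_normD _ _) _.
rewrite (normrM (p2 _)) normrX (normrM (p1 _)).
have h1 : `|rho^-1 * D1 t| ^+ 2 <= B1 ^+ 2 by rewrite lerXn2r// ?nnegrE// rD.
have h2 := rD _ _ d2.
have g1 : `|p2 ((D t - j) / rho)| * `|rho^-1 * D1 t| ^+ 2 <= w * B1 ^+ 2.
  by apply: ler_pM => //; exact: le_trans dec.
have g2 : `|p1 ((D t - j) / rho)| * `|rho^-1 * D2 t| <= w * B2.
  by apply: ler_pM => //; exact: le_trans dec.
by lra.
Qed.

End TestFunction.

(** * Integration by parts on an edge *)

Section IntegrationByParts.
Context {R : realType}.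
Notation leb := (@lebesgue_measure R).
Variables (l : R) (f : R -> R).
Hypothesis l0 : 0 < l.
Local Notation f1 := (derive_on `[0, l] f).
Local Notation f2 := (derive1n 2 f).
Hypothesis fC2 : forall t : R, 0 < t < l ->
  [/\ derivable f t 1, derivable (derive1 f) t 1 & {for t, continuous f2}].
Hypothesis fC1 : C_on 1 `[0, l] f.
Hypothesis fLoo : exists M : R,
  {ae leb, forall t : R, 0 < t < l -> `|f2 t| <= M}.

Lemma second_derivative_integrable : leb.-integrable `]0, l[ (EFin \o f2).
Proof.
have mf2 : measurable_fun `]0, l[ f2.
  apply: open_continuous_measurable_fun; first exact: interval_open.
  by move=> t; rewrite inE/= in_itv/= => /fC2[].
have [M fM] := fLoo.
apply/integrableP; split; first exact/measurable_EFinP.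
apply: (@le_lt_trans _ _ (\int[leb]_(x in `]0%R, l[) (`|M|)%:E)%E).
  apply: ae_ge0_le_integral => //.
  - by apply: measurableT_comp => //; exact/measurable_EFinP.
  - case: fM => N [mN N0 sub]; exists N; split => // t /= nt; apply: sub => /= h.
    apply: nt; rewrite in_itv/= => tl; rewrite lee_fin.
    exact: le_trans (h tl) (ler_norm _).
rewrite integral_cst//= lebesgue_measure_itv/= lte_fin l0.
by rewrite -EFinD -EFinM ltry.
Qed.

Lemma integrable_mulcont (h g : R -> R) : continuous h ->
  leb.-integrable `]0, l[ (EFin \o g) ->
  leb.-integrable `]0, l[ (EFin \o (h \* g)).
Proof.
move=> ch ig; rewrite (_ : _ \o _ = ((EFin \o h) \* (EFin \o g))%E)//.
apply: integrableMr => //.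
  exact: measurable_funTS (continuous_measurable_fun ch).
have [M M0 hM] := continuous_bounded_itv (ltW l0) ch.
exists M; split; first exact: num_real.
move=> x Mx t; rewrite /= in_itv/= => /andP[t0 tl].
by apply: le_trans (ltW Mx); apply: hM; rewrite !ltW.
Qed.

Let fc : {within `[0, l], continuous f}. Proof. by case: fC1. Qed.

Lemma integrable_edge : leb.-integrable `]0, l[ (EFin \o f).
Proof.
have ic : leb.-integrable `[0, l] (EFin \o f).
  exact: continuous_compact_integrable (@segment_compact _ _ _) fc.
by apply: integrableS ic => //; exact: subset_itv_oo_cc.
Qed.

(** The difference of the two integrands is the derivative of
    [p * f' - p' * f]. *)
Lemma integration_by_parts_edge (p p1 p2 : R -> R) : C2_jet p p1 p2 ->
  (\int[leb]_(t in `]0%R, l[) (p t * f2 t)%:E =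
   ((p l * f1 l - p1 l * f l) - (p 0 * f1 0 - p1 0 * f 0))%:E +
   \int[leb]_(t in `]0%R, l[) (f t * p2 t)%:E)%E.
Proof.
move=> J; have cp := jet_cont0 J; have cp1 := jet_cont1 J.
case: fC1 => _ [df [cf1 _]].
have i1 := integrable_mulcont cp second_derivative_integrable.
have i2 := integrable_mulcont (jet_cont2 J) integrable_edge.
have dfi t : 0 < t < l -> is_derive t 1 f (f1 t).
  move=> tl; have it : (`[0, l]%classic)° t.
    by rewrite interior_itv_bnd/= in_itv.
  exact: is_derive_derive_on it (df _ (interior_subset it)).
have df1i t : 0 < t < l -> is_derive t 1 f1 (f2 t).
  move=> tl; have [_ d1 _] := fC2 tl.
  apply: (near_eq_is_derive (f := derive1 f)).
    have /andP[t0 t1] := tl.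
    near=> s; have [_ <-] : is_derive s 1 f (f1 s).
      apply: dfi; apply/andP; split; near: s; [exact: lt_nbhsr|exact: lt_nbhsl].
    by rewrite derive1E.
  have -> : f2 t = 'D_1 (derive1 f) t by rewrite -derive1E.
  exact: derivableP.
have cf t : 0 < t < l -> {for t, continuous f}.
  by move=> /dfi; exact: is_derive_continuous.
have itv t : t \in `]0, l[ -> 0 < t < l by rewrite in_itv.
have := @FTC2_oo R (fun t => p t * f2 t - p2 t * f t)
  (fun t => p t * f1 t - p1 t * f t) 0 l l0.
move=> /(_ _ _ _ _) FTC.
rewrite -(FTC _ _ _ _).
- under [in X in (_ + X)%E]eq_integral do rewrite mulrC.
  rewrite -integralD_EFin//.
    by apply: eq_integral => t _; rewrite /= -EFinD subrK.
  exact: integrableB i1 i2.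
- exact: integrableB i1 i2.
- move=> t /itv tl; apply: cvgB; apply: cvgM.
  + exact: cp.
  + by case: (fC2 tl).
  + exact: (jet_cont2 J).
  + exact: cf.
- move=> t; apply: cvgB; apply: cvgM; [exact: continuous_subspaceT|exact: cf1
    |exact: continuous_subspaceT|exact: fc].
- move=> t /itv tl; have ? := dfi _ tl; have ? := df1i _ tl.
  have ? := jet_derive1 J t; have ? := jet_derive2 J t.
  by apply: is_derive_eq; rewrite /GRing.scale/=; ring.
Unshelve. all: by end_near. Qed.

End IntegrationByParts.

(** * Signed sums over countable families *)

Section TotalSum.
Context {R : realType}.
Local Open Scope ereal_scope.

Lemma summable_EFin_le (I : choiceType) (F : I -> R) (g : I -> \bar R) :
  (forall i, (`|F i|%R)%:E <= g i) -> \esum_(i in [set: I]) g i < +oo ->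
  summable [set: I] (fun i => (F i)%:E).
Proof. by move=> Fg; apply: le_lt_trans; apply: le_esum => i _; exact: Fg. Qed.

(** The positive and negative parts in [total_sum] may be replaced by any
    splitting into nonnegative summable families. This is how all the algebra of
    signed sums reduces to that of nonnegative ones. *)
Lemma total_sum_sub (I : choiceType) (P N : I -> \bar R) :
  (forall i, 0 <= P i) -> (forall i, 0 <= N i) ->
  \esum_(i in [set: I]) P i < +oo -> \esum_(i in [set: I]) N i < +oo ->
  total_sum (fun i => P i - N i) =
  \esum_(i in [set: I]) P i - \esum_(i in [set: I]) N i.
Proof.
move=> P0 N0 Poo Noo; apply: esumB => //; rewrite /summable.
  by under eq_esum do rewrite gee0_abs//.
by under eq_esum do rewrite gee0_abs//.
Qed.

Lemma eq_total_sum (I : choiceType) (F G : I -> \bar R) :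
  (forall i, F i = G i) -> total_sum F = total_sum G.
Proof. by move=> /funext ->. Qed.

Lemma total_sumD (I : choiceType) (F G : I -> \bar R) :
  summable [set: I] F -> summable [set: I] G ->
  total_sum (F \+ G) = total_sum F + total_sum G.
Proof.
move=> sF sG.
have fin (h : I -> \bar R) : (forall i, 0 <= h i) -> summable [set: I] h ->
    \esum_(i in [set: I]) h i \is a fin_num.
  move=> h0; rewrite summableE; congr (_ \is a fin_num).
  by apply: eq_esum => i _; rewrite gee0_abs.
have Fp := summable_funepos sF; have Fn := summable_funeneg sF.
have Gp := summable_funepos sG; have Gn := summable_funeneg sG.
have lt (h k : I -> \bar R) : (forall i, 0 <= h i) -> (forall i, 0 <= k i) ->
    summable [set: I] h -> summable [set: I] k ->
    \esum_(i in [set: I]) (h \+ k) i < +oo.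
  move=> h0 k0 hs ks; have := summableD hs ks; rewrite /summable.
  by under eq_esum do rewrite gee0_abs ?adde_ge0//.
rewrite funeD_posD total_sum_sub//=; last 4 first.
- by move=> i; rewrite adde_ge0.
- by move=> i; rewrite adde_ge0.
- exact: lt.
- exact: lt.
rewrite !esumD// /total_sum.
have := fin _ (fun=> funepos_ge0 _ _) Fp; have := fin _ (fun=> funeneg_ge0 _ _) Fn.
have := fin _ (fun=> funepos_ge0 _ _) Gp; have := fin _ (fun=> funeneg_ge0 _ _) Gn.
do 4 move=> /fineK <-.
by rewrite !(=^~ EFinD, =^~ EFinN); congr EFin; ring.
Qed.

Lemma esum_exchange (I J : choiceType) (a : I -> J -> \bar R) :
  (forall i j, 0 <= a i j) ->
  \esum_(i in [set: I]) \esum_(j in [set: J]) a i j =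
  \esum_(j in [set: J]) \esum_(i in [set: I]) a i j.
Proof.
move=> a0; rewrite !esum_esum//.
rewrite (@reindex_esum _ _ _ ([set: J] `*`` (fun=> [set: I])) _
  (fun k => (k.2, k.1)))//.
split => [[x y] //|[x y] [x' y'] _ _ [-> ->] //|[x y] _ /=].
by exists (y, x).
Qed.

Lemma esum_fin (I : choiceType) (A : set I) (q : I -> R) : finite_set A ->
  (forall i, (0 <= q i)%R) -> (forall i, ~ A i -> q i = 0%R) ->
  \esum_(i in [set: I]) (q i)%:E = (\sum_(i \in A) q i)%:E.
Proof.
move=> Af q0 qA; rewrite -fsumEFin// -esum_fset//; last by move=> i _; rewrite lee_fin.
rewrite [RHS]esum_mkcond; apply: eq_esum => i _.
by case: ifPn => //; rewrite notin_setE => /qA ->.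
Qed.

Lemma total_sum_fin (I : choiceType) (A : set I) (F : I -> R) :
  finite_set A -> (forall i, ~ A i -> F i = 0%R) ->
  total_sum (fun i => (F i)%:E) = (\sum_(i \in A) F i)%:E.
Proof.
move=> Af FA; rewrite /total_sum.
pose p i := Num.max (F i) 0%R; pose n i := Num.max (- F i)%R 0%R.
have -> : (fun i => (F i)%:E)^\+ = fun i => (p i)%:E.
  by apply/funext => i; rewrite funeposE EFin_max.
have -> : (fun i => (F i)%:E)^\- = fun i => (n i)%:E.
  by apply/funext => i; rewrite funenegE -EFinN EFin_max.
rewrite !(esum_fin Af); first last.
- by move=> i /FA; rewrite /p => ->; rewrite maxxx.
- by move=> i; rewrite /p le_max lexx orbT.
- by move=> i /FA; rewrite /n => ->; rewrite oppr0 maxxx.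
- by move=> i; rewrite /n le_max lexx orbT.
rewrite -EFinB; congr EFin; apply/eqP; rewrite subr_eq -fsbig_split//=.
apply/eqP/eq_fsbigr => i _; rewrite /p /n.
have [h|h] := leP 0%R (F i).
  by rewrite max_r ?addr0// oppr_le0.
by rewrite max_l ?subrr// oppr_ge0 ltW.
Qed.

Lemma total_sum_exchange (I J : choiceType) (a : I -> J -> \bar R) :
  \esum_(i in [set: I]) \esum_(j in [set: J]) `|a i j| < +oo ->
  total_sum (fun i => total_sum (a i)) = total_sum (fun j => total_sum (a^~ j)).
Proof.
move=> aoo.
have le (b : I -> J -> \bar R) : (forall i j, b i j <= `|a i j|) ->
    \esum_(i in [set: I]) \esum_(j in [set: J]) b i j < +oo.
  by move=> ba; apply: le_lt_trans aoo; apply: le_esum => i _; apply: le_esum.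
pose p i j := maxe (a i j) 0; pose n i j := maxe (- a i j) 0.
have p0 i j : 0 <= p i j by rewrite le_max lexx orbT.
have n0 i j : 0 <= n i j by rewrite le_max lexx orbT.
have ple i j : p i j <= `|a i j| by rewrite ge_max lee_abs abse_ge0.
have nle i j : n i j <= `|a i j| by rewrite ge_max -abseN lee_abs abse_ge0.
have pE : (fun i => total_sum (a i)) = fun i =>
    \esum_(j in [set: J]) p i j - \esum_(j in [set: J]) n i j.
  apply/funext => i; rewrite /total_sum; congr (_ - _); apply: eq_esum => j _.
    by rewrite funeposE.
  by rewrite funenegE.
have nE : (fun j => total_sum (a^~ j)) = fun j =>
    \esum_(i in [set: I]) p i j - \esum_(i in [set: I]) n i j.
  apply/funext => j; rewrite /total_sum; congr (_ - _); apply: eq_esum => i _.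
    by rewrite funeposE.
  by rewrite funenegE.
rewrite pE nE.
rewrite (@total_sum_sub _ (fun i => \esum_(j in [set: J]) p i j)
  (fun i => \esum_(j in [set: J]) n i j)); last 4 first.
- by move=> i; apply: esum_ge0.
- by move=> i; apply: esum_ge0.
- exact: le.
- exact: le.
rewrite (@total_sum_sub _ (fun j => \esum_(i in [set: I]) p i j)
  (fun j => \esum_(i in [set: I]) n i j)); last 4 first.
- by move=> i; apply: esum_ge0.
- by move=> i; apply: esum_ge0.
- by rewrite -esum_exchange//; exact: le.
- by rewrite -esum_exchange//; exact: le.
by rewrite esum_exchange// [X in _ - X = _]esum_exchange.
Qed.

(** Both rearrangements in the proof of the theorem, of the weighted differences
    over pairs of adjacent vertices and of the normal derivatives over incident
    pairs, are of this kind: local finiteness makes rows and columns finite. *)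
Lemma fubini_finite_rows (I J : choiceType) (a : I -> J -> R)
    (A : I -> set J) (B : J -> set I) :
  (forall i, finite_set (A i)) -> (forall j, finite_set (B j)) ->
  (forall i j, ~ A i j -> a i j = 0%R) -> (forall i j, ~ B j i -> a i j = 0%R) ->
  \esum_(i in [set: I]) \esum_(j in [set: J]) (`|a i j|%R)%:E < +oo ->
  [/\ summable [set: I] (fun i => (\sum_(j \in A i) a i j)%:E),
      summable [set: J] (fun j => (\sum_(i \in B j) a i j)%:E) &
      total_sum (fun i => (\sum_(j \in A i) a i j)%:E) =
      total_sum (fun j => (\sum_(i \in B j) a i j)%:E)].
Proof.
move=> Af Bf aA aB aoo.
have row (K : choiceType) (C : set K) (b : K -> R) : finite_set C ->
    (forall k, ~ C k -> b k = 0%R) ->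
    `|\sum_(k \in C) b k|%:E <= \esum_(k in [set: K]) (`|b k|%R)%:E.
  move=> Cf bC; rewrite (esum_fin Cf)//; last by move=> k /bC ->; rewrite normr0.
  by rewrite lee_fin !fsbig_finite//= ler_norm_sum.
split.
- by apply: summable_EFin_le aoo => i; exact: row (Af i) (aA i).
- rewrite esum_exchange// in aoo.
  by apply: summable_EFin_le aoo => j; exact: row (Bf j) (fun i => @aB i j).
- transitivity (total_sum (fun i => total_sum (fun j => (a i j)%:E))).
    by apply: eq_total_sum => i; rewrite (total_sum_fin (Af i))//; exact: aA.
  rewrite total_sum_exchange//; apply: eq_total_sum => j.
  by rewrite (total_sum_fin (Bf j))// => i; exact: aB.
Qed.

Local Close Scope ereal_scope.

Lemma ler_fsum (I : choiceType) (A : set I) (f g : I -> R) : finite_set A ->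
  (forall i, A i -> f i <= g i) -> \sum_(i \in A) f i <= \sum_(i \in A) g i.
Proof.
move=> Af fg; rewrite !fsbig_finite// big_seq [leRHS]big_seq.
by apply: ler_sum => i; rewrite in_fset_set// => /set_mem; exact: fg.
Qed.

Lemma esum_mull_lty (I : choiceType) (c : R) (F : I -> \bar R) : 0 <= c ->
  (forall i, (0 <= F i)%E) -> (\esum_(i in [set: I]) F i < +oo)%E ->
  (\esum_(i in [set: I]) (c%:E * F i) < +oo)%E.
Proof.
move=> c0 F0 Foo; apply: (@le_lt_trans _ _ (c%:E * \esum_(i in [set: I]) F i)%E).
  apply: ge_ereal_sup => _ [X XI <-]; rewrite -ge0_mule_fsumr//.
  by rewrite lee_wpmul2l ?lee_fin// ereal_sup_ubound//; exists X.
by rewrite lte_mul_pinfty// lee_fin.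
Qed.

End TotalSum.

(** * End slopes of concave functions *)

Section EdgeBounds.
Context {R : realType}.
Notation leb := (@lebesgue_measure R).

(** If [K] is positive then [w] is nonnegative by the hypothesis; for [K = 0] the
    sign of [w] is unknown but the left-hand side vanishes. *)
Lemma integral_mul_le (l K : R) (f g w : R -> R) : 0 <= K ->
  measurable_fun `]0, l[ f -> measurable_fun `]0, l[ g ->
  measurable_fun `]0, l[ w ->
  (forall t, 0 < t < l -> `|g t| <= K * w t) ->
  (\int[leb]_(t in `]0%R, l[) (`|f t * g t|%R)%:E <=
   K%:E * \int[leb]_(t in `]0%R, l[) (`|f t| * w t)%:E)%E.
Proof.
move=> K0 mf mg mw gw.
have [K00|Kpos] := eqVneq K 0.
  rewrite K00 mul0e; apply: (@le_trans _ _ (\int[leb]_(t in `]0%R, l[) 0%E)%E);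
    last by rewrite integral0.
  apply: ge0_le_integral => //.
  - by apply/measurable_EFinP; apply: measurableT_comp => //; exact: measurable_funM.
  - move=> t; rewrite /= in_itv/= => /gw; rewrite K00 mul0r normr_le0 => /eqP ->.
    by rewrite mulr0 normr0.
have w0 t : 0 < t < l -> 0 <= w t.
  move=> /gw h; rewrite -(pmulr_rge0 _ (_ : 0 < K)) ?(le_trans _ h)//.
  by rewrite lt_neqAle eq_sym Kpos.
have fw0 t : `]0, l[%classic t -> (0 <= (`|f t| * w t)%:E)%E.
  by move=> tl; rewrite lee_fin mulr_ge0// w0//; move: tl; rewrite /= in_itv.
have mfw : measurable_fun `]0, l[ (fun t => (`|f t| * w t)%:E).
  by apply/measurable_EFinP; apply: measurable_funM => //; exact: measurableT_comp.
rewrite -ge0_integralZl_EFin//.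
apply: ge0_le_integral => //.
- by apply/measurable_EFinP; apply: measurableT_comp => //; exact: measurable_funM.
- exact: measurable_funeM.
- move=> t; rewrite /= in_itv/= => tl.
  rewrite -EFinM lee_fin normrM mulrCA ler_wpM2l//; exact: gw.
Qed.

End EdgeBounds.

Section Slopes.
Context {R : realType}.
Notation leb := (@lebesgue_measure R).
Variables (l : R) (f : R -> R).
Hypothesis l0 : 0 < l.
Local Notation f1 := (derive_on `[0, l] f).
Local Notation f2 := (derive1n 2 f).
Hypothesis fC2 : forall t : R, 0 < t < l ->
  [/\ derivable f t 1, derivable (derive1 f) t 1 & {for t, continuous f2}].
Hypothesis fC1 : C_on 1 `[0, l] f.
Hypothesis fLoo : exists M : R,
  {ae leb, forall t : R, 0 < t < l -> `|f2 t| <= M}.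
Hypothesis concave : forall t : R, 0 < t < l -> f2 t <= 0.

(** In the integration by parts the integral of [p * f''] is nonpositive, and the
    other one is controlled by the integral of [|f|]. *)
Lemma concave_boundary_le (p p1 p2 : R -> R) (M : R) : C2_jet p p1 p2 ->
  (forall t, 0 < t < l -> 0 <= p t) -> 0 <= M ->
  (forall t, 0 < t < l -> `|p2 t| <= M) ->
  (((p l * f1 l - p1 l * f l) - (p 0 * f1 0 - p1 0 * f 0))%:E <=
   M%:E * \int[leb]_(t in `]0%R, l[) (`|f t|)%:E)%E.
Proof.
move=> J p0 M0 p2M; have := integration_by_parts_edge l0 fC2 fC1 fLoo J.
set B := _ - _ => E.
have fi := integrable_edge fC1.
have i2 := integrable_mulcont l0 (jet_cont2 J) fi.
have mf : measurable_fun `]0, l[ f.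
  by apply/measurable_EFinP; case/integrableP : fi.
have mp2 : measurable_fun `]0, l[ p2.
  exact: measurable_funTS (continuous_measurable_fun (jet_cont2 J)).
have X0 : (\int[leb]_(t in `]0%R, l[) (p t * f2 t)%:E <= 0)%E.
  have i1 := integrable_mulcont l0 (jet_cont0 J)
    (second_derivative_integrable l0 fC2 fLoo).
  rewrite -oppe_ge0 -integralN; last by apply: integrable_add_def => //; exact: i1.
  apply: integral_ge0 => t; rewrite /= in_itv/= => tl.
  rewrite lee_fin -mulrN; apply: mulr_ge0; first exact: p0.
  by rewrite oppr_ge0; exact: concave.
have Yfin : (\int[leb]_(t in `]0%R, l[) (f t * p2 t)%:E)%E \is a fin_num.
  under eq_integral do rewrite mulrC.
  exact: integrable_fin_num i2.
have YM : (`|\int[leb]_(t in `]0%R, l[) (f t * p2 t)%:E| <=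
    M%:E * \int[leb]_(t in `]0%R, l[) (`|f t|)%:E)%E.
  apply: le_trans (le_abse_integral _ _ _) _ => //.
    by apply/measurable_EFinP; exact: measurable_funM.
  have -> : (\int[leb]_(t in `]0%R, l[) (`|f t|)%:E =
             \int[leb]_(t in `]0%R, l[) (`|f t| * cst 1%R t)%:E)%E.
    by apply: eq_integral => t _; rewrite /= mulr1.
  by apply: integral_mul_le => // t tl; rewrite mulr1 p2M.
apply: le_trans YM; move: X0; rewrite E.
set Y := integral _ _ _; rewrite -/Y in Yfin *.
rewrite -(fineK Yfin) -EFinD lee_fin abse_EFin lee_fin => h.
by have := ler_norm (- fine Y); rewrite normrN; lra.
Qed.

(** The outward slopes of a concave function are bounded above by its integral
    norm: test it against a step that is 1 at one end of the interval, 0 at the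
    other, and flat at both. No bound from below is possible, since a concave
    function may fall or rise arbitrarily steeply near an end point. The constant
    [M] is that of [two_steps_bound] for one step of height 1. *)
Lemma concave_end_slopes (C : R) (e0 e1 e2 : R -> R) (r : R) :
  smooth_step C e0 e1 e2 -> 0 < r -> r <= l ->
  let M := 2 * 1 * r^-1 ^+ 2 * C in
  let I := (\int[leb]_(t in `]0%R, l[) (`|f t|)%:E)%E in
  ((f1 l)%:E <= M%:E * I /\ (- f1 0)%:E <= M%:E * I)%E.
Proof.
move=> H r0 rl M I; have C0 := smooth_step_bound_ge0 H.
have M0 : 0 <= M.
  apply: mulr_ge0 => //; apply: mulr_ge0; first by rewrite mulr1.
  by apply: exprn_ge0; rewrite invr_ge0 ltW.
have lN0 : l != 0 by rewrite gt_eqF.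
have k : `|l^-1| <= r^-1 by rewrite gtr0_norm ?invr_gt0// lef_pV2.
have bd c : `|c| <= 1 -> forall t, 0 < t < l -> `|two_steps2 e2 c 0 l^-1 0 t| <= M.
  move=> c1 t _; have z : `|0 : R| <= 1 by rewrite normr0.
  by have [_ ?] := two_steps_bound H 0 t c1 z k.
have rg A c t : two_steps e0 A c 0 l^-1 0 t = A + c * e0 (l^-1 * t).
  by rewrite /two_steps mul0r addr0.
have d10 c : two_steps1 e1 c 0 l^-1 0 0 = 0.
  by rewrite /two_steps1 mulr0 (step_left H (lexx 0)).2 !mul0r mulr0 addr0.
have d1l c : two_steps1 e1 c 0 l^-1 0 l = 0.
  by rewrite /two_steps1 mulVf// (step_right H (lexx 1)).2 !mul0r mulr0 addr0.
have e00 := (step_left H (lexx 0)).1; have e11 := (step_right H (lexx 1)).1.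
split.
- have := concave_boundary_le (two_steps_jet H 0 1 0 l^-1 0) _ M0 (bd 1 _).
  rewrite !rg d10 d1l mulr0 mulVf// e00 e11 !mul0r !subr0 !add0r !mul1r mul0r.
  rewrite subr0; apply.
    by move=> t _; rewrite rg; have := step_range H (l^-1 * t); lra.
  by rewrite normr1.
- have := concave_boundary_le (two_steps_jet H 1 (-1) 0 l^-1 0) _ M0 (bd (-1) _).
  rewrite !rg d10 d1l mulr0 mulVf// e00 e11 mulr1 subrr !mul0r !subr0 mulr0.
  rewrite addr0 mul1r sub0r; apply.
    by move=> t _; rewrite rg; have := step_range H (l^-1 * t); lra.
  by rewrite normrN1.
Qed.

End Slopes.

(** * The identity at the vertices *)

Section VertexGreen.
Context {R : realType} (G : metric_graph R).

Lemma adj_sym (x y : vertex G) : adj x y -> adj y x.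
Proof. by case=> e [[? ?]|[? ?]]; exists e; [right|left]. Qed.

Lemma finite_adj (x : vertex G) : locally_finite G -> finite_set [set y | adj x y].
Proof.
move=> lf; apply: (@sub_finite_set _ _ (@ini R G @` [set e | incident x e] `|`
  @fin R G @` [set e | incident x e])).
  by move=> y [e [[ix fy]|[iy fx]]]; [right|left]; exists e => //; [left|right].
by rewrite finite_setU; split; apply: finite_image.
Qed.

(** Up to a common diagonal term, both integrands are sums of the double family
    [omega x y * p x * u y], once over its rows and once over its columns. Its
    absolute sum is finite because the weight [W] varies by a bounded factor
    between adjacent vertices and the total conductance at a vertex is at most
    [Cw * mu]. *)
Lemma vertex_green (mu : vertex G -> R) (omega : vertex G -> vertex G -> R)
    (p u : gpoint G -> R) (W : vertex G -> R) (Cw K E : R) :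
  (forall x, 0 < mu x) -> (forall x y, adj x y -> 0 < omega x y) ->
  (forall x y, omega x y = omega y x) -> locally_finite G ->
  0 <= Cw -> 0 <= K -> 0 <= E -> (forall v, 0 <= W v) ->
  (forall x, \sum_(y \in [set y | adj x y]) omega x y <= Cw * mu x) ->
  (forall v, 0 <= p (vpt v) <= K * W v) ->
  (forall x y, adj x y -> W y <= E * W x) ->
  (\esum_(v in [set: vertex G]) (mu v * `|u (vpt v)| * W v)%:E < +oo)%E ->
  [/\ integrable_V mu (fun x => p (vpt x) * lap_V mu omega u x),
      integrable_V mu (fun x => u (vpt x) * lap_V mu omega p x) &
      int_V mu (fun x => p (vpt x) * lap_V mu omega u x) =
      int_V mu (fun x => u (vpt x) * lap_V mu omega p x)].
Proof.
move=> mu0 om0 omS lf Cw0 K0 E0 W0 omC pK WE uX.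
pose N x := [set y : vertex G | adj x y].
have Nf x : finite_set (N x) by exact: finite_adj.
pose a x y : R :=
  if `[< adj x y >] then omega x y * p (vpt x) * u (vpt y) else 0.
pose S x := \sum_(y \in N x) omega x y.
have S0 x : 0 <= S x by apply: fsumr_ge0 => y /om0 /ltW.
pose c x := p (vpt x) * u (vpt x) * S x.
pose g v := (mu v * `|u (vpt v)| * W v)%:E.
have g0 v : (0 <= g v)%E by rewrite lee_fin !mulr_ge0// ltW.
have aN x y : ~ N x y -> a x y = 0 by move=> nxy; rewrite /a ifN//; apply/asboolPn.
have aN' x y : ~ N y x -> a x y = 0 by move=> nxy; apply: aN => /adj_sym.
have aE x y : N x y -> a x y = omega x y * p (vpt x) * u (vpt y).
  by move=> xy; rewrite /a ifT//; apply/asboolP.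
have aoo : (\esum_(x in [set: vertex G]) \esum_(y in [set: vertex G])
    (`|a x y|%R)%:E < +oo)%E.
  rewrite esum_exchange; last by move=> x y; rewrite lee_fin.
  have KEC : 0 <= K * E * Cw by rewrite !mulr_ge0.
  apply: le_lt_trans (esum_mull_lty KEC g0 uX); apply: le_esum => y _.
  rewrite (esum_fin (Nf y))//; last first.
    by move=> x /aN' ->; rewrite normr0.
  rewrite -EFinM lee_fin.
  have -> : K * E * Cw * (mu y * `|u (vpt y)| * W y) =
    (Cw * mu y) * (K * (E * W y) * `|u (vpt y)|) by ring.
  apply: le_trans (ler_wpM2r _ (omC y)); last by rewrite !mulr_ge0.
  rewrite mulr_fsuml; apply: ler_fsum => //= x xy.
  have := xy; move=> /adj_sym yx.
  rewrite aE// !normrM (gtr0_norm (om0 _ _ yx)) omS -mulrA.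
  have /andP[px0 pxK] := pK x; rewrite (ger0_norm px0).
  apply: ler_wpM2l; first by rewrite ltW// om0.
  by apply: ler_wpM2r => //; apply: le_trans pxK _; apply: ler_wpM2l => //; exact: WE.
have cS : summable [set: vertex G] (fun x => (- c x)%:E).
  have KC : 0 <= K * Cw by rewrite !mulr_ge0.
  apply: summable_EFin_le (esum_mull_lty KC g0 uX) => x.
  have /andP[px0 pxK] := pK x.
  rewrite normrN /c !normrM (ger0_norm px0) (ger0_norm (S0 x)).
  rewrite -EFinM lee_fin.
  have -> : K * Cw * (mu x * `|u (vpt x)| * W x) =
    (K * W x) * `|u (vpt x)| * (Cw * mu x) by ring.
  apply: ler_pM => //; [exact: mulr_ge0|exact: ler_wpM2r|exact: omC].
have [rS sS rs] := fubini_finite_rows Nf Nf aN aN' aoo.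
have cE x : - c x = \sum_(y \in N x) - (p (vpt x) * u (vpt x) * omega x y).
  rewrite /c /S -mulNr mulr_fsumr.
  by under eq_fsbigr do rewrite mulNr.
have FE x : mu x * (p (vpt x) * lap_V mu omega u x) = \sum_(y \in N x) a x y + - c x.
  have m0 : mu x != 0 by rewrite gt_eqF.
  rewrite /lap_V mulrCA mulVKf// mulr_fsumr cE -fsbig_split//=.
  by apply: eq_fsbigr => y /set_mem xy; rewrite aE//; ring.
have HE x : mu x * (u (vpt x) * lap_V mu omega p x) = \sum_(y \in N x) a y x + - c x.
  have m0 : mu x != 0 by rewrite gt_eqF.
  rewrite /lap_V mulrCA mulVKf// mulr_fsumr cE -fsbig_split//=.
  apply: eq_fsbigr => y /set_mem xy.
  by rewrite aE; [rewrite (omS y x); ring|exact: adj_sym].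
have FE' : (fun x => (mu x * (p (vpt x) * lap_V mu omega u x))%:E) =
   (fun x => (\sum_(y \in N x) a x y)%:E) \+ (fun x => (- c x)%:E).
  by apply/funext => x; rewrite FE EFinD.
have HE' : (fun x => (mu x * (u (vpt x) * lap_V mu omega p x))%:E) =
   (fun x => (\sum_(y \in N x) a y x)%:E) \+ (fun x => (- c x)%:E).
  by apply/funext => x; rewrite HE EFinD.
rewrite /integrable_V /int_V FE' HE'; split; try exact: summableD.
by rewrite !total_sumD// rs.
Qed.
End VertexGreen.

(** * The identity on the edges *)

Section EdgeGreen.
Context {R : realType} (G : metric_graph R).
Notation leb := (@lebesgue_measure R).
Implicit Types (e : edge G) (v : vertex G).
Variables (u p W : gpoint G -> R) (K E r C : R) (s0 s1 s2 : R -> R).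
Hypotheses (u_dom : in_domain u)
  (u_concave : forall e t, 0 < t < len e -> lap_E u e t <= 0)
  (u_kirchhoff : forall v, kirchhoff u v = 0)
  (lf : locally_finite G) (loopless : forall e, ini e <> fin e)
  (K0 : 0 <= K) (E0 : 0 <= E) (r0 : 0 < r) (len_ge : forall e, r <= len e)
  (step : smooth_step C s0 s1 s2).
Hypothesis p_jets : forall e, exists P P1 P2, [/\ C2_jet P P1 P2,
    forall t, 0 <= t <= len e -> p (ept e t) = P t,
    P1 0 = 0 /\ P1 (len e) = 0 &
    forall t, 0 <= t <= len e ->
      0 <= P t <= K * W (ept e t) /\ `|P2 t| <= K * W (ept e t)].
Hypothesis p_vertex : forall v, 0 <= p (vpt v) <= K * W (vpt v).
Hypothesis W0 : forall x, 0 <= W x.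
Hypothesis W_edge : forall e v t, incident v e -> 0 <= t <= len e ->
  W (vpt v) <= E * W (ept e t).
Hypothesis W_meas : forall e, measurable_fun `]0, len e[ (fun t => W (ept e t)).

Let f e := on_edge u e.
Let f1 e := derive_on `[0, len e] (f e).
Let Iw e := (\int[leb]_(t in `]0%R, len e[) (`|on_edge u e t| * W (ept e t))%:E)%E.
Hypothesis u_X : (\esum_(e in [set: edge G]) Iw e < +oo)%E.

(* the constant of concave_end_slopes *)
Let M := 2 * 1 * r^-1 ^+ 2 * C.

Definition boundary_term e :=
  p (vpt (fin e)) * f1 e (len e) - p (vpt (ini e)) * f1 e 0.

(** The derivative of [p] along the edge vanishes at both ends, so only the
    boundary values of [p * u'] survive the integration by parts. In the last
    item the sign of the second derivative of [u] is used: it turns the identity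
    into a bound on the absolute value. *)
Lemma edge_identity e :
  [/\ leb.-integrable `]0, len e[ (EFin \o (fun t => p (ept e t) * lap_E u e t)),
      leb.-integrable `]0, len e[ (EFin \o (fun t => u (ept e t) * lap_E p e t)),
      (\int[leb]_(t in `]0%R, len e[) (p (ept e t) * lap_E u e t)%:E =
       (boundary_term e)%:E +
       \int[leb]_(t in `]0%R, len e[) (u (ept e t) * lap_E p e t)%:E)%E,
      (\int[leb]_(t in `]0%R, len e[) (`|u (ept e t) * lap_E p e t|%R)%:E <=
       K%:E * Iw e)%E &
      (\int[leb]_(t in `]0%R, len e[) (`|p (ept e t) * lap_E u e t|%R)%:E =
       - \int[leb]_(t in `]0%R, len e[) (p (ept e t) * lap_E u e t)%:E)%E].
Proof.
have [P [P1 [P2 [J pP [P10 P1l] PB]]]] := p_jets e.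
have l0 := len_gt0 e.
have c2 t : 0 < t < len e -> [/\ derivable (f e) t 1, derivable (derive1 (f e)) t 1
   & {for t, continuous (derive1n 2 (f e))}].
  exact: (domain_C2 u_dom).
have c1 : C_on 1 `[0, len e] (f e) := domain_C1 u_dom e.
have bd := domain_Linfty u_dom e.
have oo t : 0 < t < len e -> 0 <= t <= len e.
  by move=> /andP[? ?]; apply/andP; split; exact: ltW.
have lapP t : 0 < t < len e -> lap_E p e t = P2 t.
  by apply: (jet_eq_oo J) => s /oo; exact: pP.
have i1 := integrable_mulcont l0 (jet_cont0 J) (second_derivative_integrable l0 c2 bd).
have fi := integrable_edge c1.
have i2 := integrable_mulcont l0 (jet_cont2 J) fi.
have mf : measurable_fun `]0, len e[ (f e).
  by apply/measurable_EFinP; case/integrableP : fi.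
have mP2 : measurable_fun `]0, len e[ P2.
  exact: measurable_funTS (continuous_measurable_fun (jet_cont2 J)).
have E1 t : t \in `]0, len e[%classic ->
    p (ept e t) * lap_E u e t = P t * derive1n 2 (f e) t.
  by rewrite inE /= in_itv/= => /oo te; rewrite pP.
have E2 t : t \in `]0, len e[%classic ->
    u (ept e t) * lap_E p e t = f e t * P2 t.
  by rewrite inE /= in_itv/= => te; rewrite lapP.
have j1 : leb.-integrable `]0, len e[
    (EFin \o (fun t => p (ept e t) * lap_E u e t)).
  by apply: eq_integrable i1 => // t te; rewrite /= E1.
split.
- exact: j1.
- by apply: eq_integrable i2 => // t te; rewrite /= E2// mulrC.
- have := integration_by_parts_edge l0 c2 c1 bd J.
  have z0 : 0 <= (0 : R) <= len e by rewrite lexx ltW.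
  have zl : 0 <= len e <= len e by rewrite lexx ltW.
  rewrite P10 P1l !mul0r !subr0 /boundary_term -ept0 -ept_len.
  rewrite (pP _ z0) (pP _ zl) => IBP.
  have intu : (\int[leb]_(t in `]0%R, len e[) (p (ept e t) * lap_E u e t)%:E =
      \int[leb]_(t in `]0%R, len e[) (P t * derive1n 2 (f e) t)%:E)%E.
    by apply: eq_integral => t te; rewrite E1.
  have intp : (\int[leb]_(t in `]0%R, len e[) (u (ept e t) * lap_E p e t)%:E =
      \int[leb]_(t in `]0%R, len e[) (f e t * P2 t)%:E)%E.
    by apply: eq_integral => t te; rewrite E2.
  apply: (etrans intu); apply: (etrans IBP).
  exact: (congr1 (fun z => _ + z)%E (esym intp)).
- have -> : (\int[leb]_(t in `]0%R, len e[) (`|u (ept e t) * lap_E p e t|%R)%:E =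
      \int[leb]_(t in `]0%R, len e[) (`|f e t * P2 t|%R)%:E)%E.
    by apply: eq_integral => t te; rewrite E2.
  by apply: integral_mul_le => // t /oo /PB[].
- rewrite -integralN; last by apply: integrable_add_def => //; exact: j1.
  apply: eq_integral => t te; rewrite -EFinN; congr EFin; rewrite E1//.
  move: te; rewrite inE /= in_itv/= => te.
  rewrite ler0_norm// mulr_ge0_le0 ?u_concave//.
  by have [/andP[]] := PB _ (oo _ te).
Qed.

Let Aw e := (\int[leb]_(t in `]0%R, len e[) (`|on_edge u e t|%R)%:E)%E.

Lemma edge_measurable e : measurable_fun `]0, len e[ (f e).
Proof.
have := integrable_edge (domain_C1 u_dom e).
by case/integrableP => mf _; apply/measurable_EFinP.
Qed.

Lemma Aw_fin e : Aw e \is a fin_num.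
Proof.
have /integrableP[_ ioo] := integrable_edge (domain_C1 u_dom e).
by rewrite ge0_fin_numE//; apply: integral_ge0 => t _; rewrite lee_fin.
Qed.

Lemma Iw_ge0 e : (0 <= Iw e)%E.
Proof. by apply: integral_ge0 => t _; rewrite lee_fin mulr_ge0. Qed.

Lemma Iw_fin e : Iw e \is a fin_num.
Proof.
rewrite ge0_fin_numE ?Iw_ge0//; apply: le_lt_trans u_X.
by apply: esum_ge; exists [set e]; [split|rewrite fsbig_set1].
Qed.

Lemma normal_deriv_le e v : incident v e ->
  normal_deriv u e v <= M * fine (Aw e).
Proof.
have l0 := len_gt0 e.
have c2 t : 0 < t < len e -> [/\ derivable (f e) t 1, derivable (derive1 (f e)) t 1
   & {for t, continuous (derive1n 2 (f e))}].
  exact: (domain_C2 u_dom).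
have [R1 R0] := concave_end_slopes l0 c2 (domain_C1 u_dom e) (domain_Linfty u_dom e)
  (@u_concave e) step r0 (len_ge e).
rewrite /normal_deriv => -[<-|<-]; last first.
  by rewrite eqxx -lee_fin EFinM (fineK (Aw_fin e)); exact: R1.
rewrite ifN; last by apply/eqP => /esym; exact: loopless.
by rewrite -lee_fin EFinM (fineK (Aw_fin e)); exact: R0.
Qed.

Lemma weight_at_vertex e v : incident v e ->
  W (vpt v) * fine (Aw e) <= E * fine (Iw e).
Proof.
move=> ve; have Wv := W0 (vpt v).
rewrite -lee_fin !EFinM (fineK (Aw_fin e)) (fineK (Iw_fin e)).
have -> : ((W (vpt v))%:E * Aw e =
    \int[leb]_(t in `]0%R, len e[) (`|f e t * cst (W (vpt v)) t|%R)%:E)%E.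
  rewrite -ge0_integralZl_EFin//.
  - by apply: eq_integral => t _; rewrite /= normrM (ger0_norm Wv) mulrC EFinM.
  - by apply/measurable_EFinP; apply: measurableT_comp => //; exact: edge_measurable.
apply: integral_mul_le => //; first exact: edge_measurable.
move=> t te; rewrite /= ger0_norm//; apply: W_edge => //.
by case/andP: te => ? ?; apply/andP; split; exact: ltW.
Qed.

Lemma smooth_const_ge0 : 0 <= M.
Proof.
apply: mulr_ge0; last exact: smooth_step_bound_ge0 step.
by apply: mulr_ge0; [rewrite mulr1|apply: exprn_ge0; rewrite invr_ge0 ltW].
Qed.

(** Regrouped by vertices, the boundary terms are [p v] times the Kirchhoff sum,
    which is zero; the point is that the regrouping is legitimate. The normal
    derivatives [n] at [v] sum to zero and are bounded above by quantities [c]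
    whose weighted sum is finite; hence [|n| <= 2 c - n], and summing over the
    edges at [v] gives at most twice the sum of the [c]. *)
Lemma boundary_terms_cancel :
  summable [set: edge G] (fun e => (boundary_term e)%:E) /\
  total_sum (fun e => (boundary_term e)%:E) = 0%E.
Proof.
have M0 := smooth_const_ge0.
pose a e v : R :=
  if `[< incident v e >] then p (vpt v) * normal_deriv u e v else 0.
have aE e v : incident v e -> a e v = p (vpt v) * normal_deriv u e v.
  by move=> ve; rewrite /a ifT//; apply/asboolP.
have aN e v : ~ incident v e -> a e v = 0.
  by move=> ve; rewrite /a ifN//; apply/asboolPn.
pose Q := 2 * M * K * E.
have M2 : 0 <= 2 * M := mulr_ge0 (ler0n R 2) M0.
have Q0 : 0 <= Q := mulr_ge0 (mulr_ge0 M2 K0) E0.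
have iw0 e : 0 <= fine (Iw e) by rewrite fine_ge0// Iw_ge0.
pose b e v : R := if `[< incident v e >] then Q * fine (Iw e) else 0.
have b0 e v : 0 <= b e v by rewrite /b; case: ifP => // _; rewrite mulr_ge0.
have bN e v : ~ incident v e -> b e v = 0.
  by move=> ve; rewrite /b ifN//; apply/asboolPn.
pose V e := [set v : vertex G | incident v e].
have VE e : V e = [set ini e] `|` [set fin e].
  by apply/seteqP; split => v [] /= ->; [left|right|left|right].
have Vf e : finite_set (V e) by rewrite VE finite_setU; split; exact: finite_set1.
have V2 e (h : vertex G -> R) : \sum_(v \in V e) h v = h (ini e) + h (fin e).
  rewrite VE fsbigU0//=; first by rewrite !fsbig_set1.
  by move=> v [/= -> /loopless].
have aoo : (\esum_(e in [set: edge G]) \esum_(v in [set: vertex G])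
    (`|a e v|%R)%:E < +oo)%E.
  rewrite esum_exchange; last by move=> x y; rewrite lee_fin.
  apply: (@le_lt_trans _ _ (\esum_(v in [set: vertex G])
    \esum_(e in [set: edge G]) (b e v)%:E)%E).
    apply: le_esum => v _; rewrite (esum_fin (lf v))//; last first.
      by move=> e /aN ->; rewrite normr0.
    rewrite (esum_fin (lf v))// ?lee_fin; last by move=> e; exact: bN.
    have /andP[pv0 pvK] := p_vertex v.
    apply: (@le_trans _ _ (\sum_(e \in [set e | incident v e])
        (p (vpt v) * (2 * M * fine (Aw e)) + - p (vpt v) * normal_deriv u e v))).
      apply: ler_fsum => // e ve; rewrite aE// normrM (ger0_norm pv0).
      rewrite mulNr -mulrN -mulrDr.
      apply: ler_wpM2l => //; have := normal_deriv_le ve.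
      have ar0 : 0 <= M * fine (Aw e).
        by rewrite mulr_ge0// fine_ge0// integral_ge0// => t _; rewrite lee_fin.
      by rewrite ler_norml; lra.
    rewrite fsbig_split//= -[X in _ + X]mulr_fsumr -/(kirchhoff u v).
    rewrite u_kirchhoff mulr0 addr0.
    apply: ler_fsum => // e ve; rewrite /b ifT; last exact/asboolP.
    have := weight_at_vertex ve => we.
    have Aw0 : 0 <= fine (Aw e).
      by rewrite fine_ge0// integral_ge0// => t _; rewrite lee_fin.
    have -> : Q * fine (Iw e) = 2 * M * (K * (E * fine (Iw e))) by rewrite /Q; ring.
    rewrite mulrCA; apply: ler_wpM2l => //.
    apply: (@le_trans _ _ (K * W (vpt v) * fine (Aw e))); first exact: ler_wpM2r.
    by rewrite -mulrA ler_wpM2l.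
  rewrite esum_exchange; last by move=> x y; rewrite lee_fin.
  have Q2 : 0 <= 2 * Q by rewrite mulr_ge0.
  apply: le_lt_trans (esum_mull_lty Q2 Iw_ge0 u_X); apply: le_esum => e _.
  rewrite (esum_fin (Vf e))//; last by move=> v; exact: bN.
  rewrite -(fineK (Iw_fin e)) -EFinM lee_fin V2.
  have bQ v : b e v <= Q * fine (Iw e).
    by rewrite /b; case: ifP => // _; rewrite mulr_ge0.
  by have := bQ (ini e); have := bQ (fin e); lra.
have [rS _ rs] := fubini_finite_rows Vf lf aN (fun e v => @aN e v) aoo.
have rowE : (fun e => (\sum_(v \in V e) a e v)%:E) = (fun e => (boundary_term e)%:E).
  apply/funext => e; congr EFin; rewrite V2 !aE; [|by right|by left].
  rewrite /normal_deriv eqxx ifN; last by apply/eqP => /esym; exact: loopless.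
  by rewrite /boundary_term /f1 /f; ring.
rewrite rowE in rS rs; split => //; rewrite rs.
have col v : \sum_(e \in [set e | incident v e]) a e v = 0.
  transitivity (p (vpt v) * kirchhoff u v); last by rewrite u_kirchhoff mulr0.
  rewrite /kirchhoff mulr_fsumr.
  by apply: eq_fsbigr => e /set_mem ve; exact: aE.
rewrite (eq_total_sum (G := fun=> 0%:E)) => [|v]; last by rewrite col.
by rewrite (total_sum_fin (F := fun=> 0) (@finite_set0 _))// fsbig_set0.
Qed.

Lemma edge_green :
  [/\ integrable_E (fun e t => p (ept e t) * lap_E u e t),
      integrable_E (fun e t => u (ept e t) * lap_E p e t) &
      int_E (fun e t => p (ept e t) * lap_E u e t) =
      int_E (fun e t => u (ept e t) * lap_E p e t)].
Proof.
have [Bs B0] := boundary_terms_cancel.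
pose Y e := (\int[leb]_(t in `]0%R, len e[) (u (ept e t) * lap_E p e t)%:E)%E.
have absY e : (`|Y e| <= K%:E * Iw e)%E.
  have [_ i2 _ b _] := edge_identity e; apply: le_trans b.
  by apply: le_abse_integral => //; case/integrableP : i2.
have Ys : summable [set: edge G] Y.
  apply: le_lt_trans (esum_mull_lty K0 Iw_ge0 u_X); apply: le_esum => e _; exact: absY.
have XE : (fun e =>
      \int[leb]_(t in `]0%R, len e[) (p (ept e t) * lap_E u e t)%:E)%E =
    ((fun e => (boundary_term e)%:E) \+ Y)%E.
  by apply/funext => e; have [_ _ -> _ _] := edge_identity e.
split.
- split=> [e|]; first (by have [i1 _ _ _ _] := edge_identity e; exact: i1).
  apply: le_lt_trans (summableD Bs Ys); apply: le_esum => e _.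
  have [_ _ E1 _ ->] := edge_identity e; rewrite E1 -/(Y e).
  by rewrite -abseN lee_abs.
- split=> [e|]; first (by have [_ i2 _ _ _] := edge_identity e; exact: i2).
  apply: le_lt_trans (esum_mull_lty K0 Iw_ge0 u_X); apply: le_esum => e _.
  by have [_ _ _ b _] := edge_identity e; exact: b.
- apply: (etrans (congr1 (@total_sum R _) XE)).
  apply: (etrans (total_sumD Bs Ys)).
  rewrite B0 add0e; exact: erefl.
Qed.

End EdgeGreen.

(** * Edge lengths and the exponential weight *)

Section Lengths.
Context {R : realType} (G : metric_graph R).

Lemma len_le_max (e : edge G) : has_ubound (range (@len R G)) -> len e <= max_len G.
Proof.
by move=> ub; apply: sup_upper_bound; [split => //; exists (len e)|]; exists e.
Qed.

Lemma min_len_le (e : edge G) : min_len G <= len e.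
Proof.
apply: ge_inf; last by exists e.
by exists 0 => _ [e' _ <-]; exact: ltW (len_gt0 e').
Qed.

(** If the graph has no edge, the supremum of the empty set is 0. *)
Lemma max_len_ge0 : has_ubound (range (@len R G)) -> 0 <= max_len G.
Proof.
move=> ub; have [[e _]|ne] := pselect (exists e : edge G, True).
  exact: le_trans (ltW (len_gt0 e)) (len_le_max e ub).
rewrite /max_len (_ : range _ = set0) ?sup0// -subset0.
by move=> s [e _ _]; apply: ne; exists e.
Qed.

End Lengths.

Section Weight.
Context {R : realType} (G : metric_graph R).
Hypothesis conn : connected_graph G.
Variables (j alpha : R) (x0 : vertex G).
Hypotheses (len_le : forall e : edge G, len e <= j) (alpha0 : 0 <= alpha).

Local Notation d x := (dist x (vpt x0)).
Local Notation W x := (expR (- (alpha * d x))).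

Lemma weight_le (x y : gpoint G) : d y <= j + d x -> W x <= expR (alpha * j) * W y.
Proof.
move=> dxy; rewrite -expRD ler_expR.
have := ler_wpM2l alpha0 dxy; lra.
Qed.

Lemma weight_edge (e : edge G) v (t : R) : incident v e -> 0 <= t <= len e ->
  W (vpt v) <= expR (alpha * j) * W (ept e t).
Proof.
move=> ve te; apply: weight_le; have l0 := len_gt0 e; have lj := len_le e.
have z0 : 0 <= (0 : R) <= len e by rewrite lexx ltW.
have zl : 0 <= len e <= len e by rewrite lexx ltW.
case: ve => <-; [rewrite -ept0|rewrite -ept_len].
  apply: le_trans (dist_step conn (vpt x0) te z0) _; rewrite lerD2r ler_norml; lra.
apply: le_trans (dist_step conn (vpt x0) te zl) _; rewrite lerD2r ler_norml; lra.
Qed.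

Lemma weight_adj (x y : vertex G) : adj x y ->
  W (vpt y) <= expR (alpha * j) * W (vpt x).
Proof.
case=> e xy; have l0 := len_gt0 e.
have z0 : 0 <= (0 : R) <= len e by rewrite lexx ltW.
have zl : 0 <= len e <= len e by rewrite lexx ltW.
case: xy => -[ie fe].
  by rewrite -[in X in _ <= X]ie -ept0; apply: weight_edge => //; right.
by rewrite -[in X in _ <= X]fe -ept_len; apply: weight_edge => //; left.
Qed.

Lemma weight_measurable (e : edge G) :
  measurable_fun `]0, len e[ (fun t : R => W (ept e t)).
Proof.
pose h (t : R) := Num.min (d (vpt (ini e)) + t) (d (vpt (fin e)) + len e - t).
apply: (@eq_measurable_fun _ _ _ _ _ (fun t => expR (- (alpha * h t)))).
  move=> t; rewrite inE /= in_itv/= => /andP[t0 tl].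
  by rewrite (dist_edge conn)// !ltW.
apply: measurableT_comp => //; apply: measurableT_comp => //.
apply: measurable_funM => //; apply: measurable_minr.
  by apply: measurable_funD.
by apply: measurable_funB.
Qed.

End Weight.

(** * Integration by parts against the test function *)

Theorem lemma4p9 (R : realType) (G : metric_graph R)
    (mu : vertex G -> R) (omega : vertex G -> vertex G -> R) (x0 : vertex G)
    (mu_gt0 : forall x, 0 < mu x)
    (omega_gt0 : forall x y, adj x y -> 0 < omega x y)
    (omega_sym : forall x y, omega x y = omega y x)
    (standing : standing_hypotheses mu omega x0)
    (eta : R -> R) (eta_ok : is_eta eta)
    (sigma : R) (sigma_gt1 : 1 < sigma)
    (V : gpoint G -> R) (V_gt0 : forall x, 0 < V x)
    (delta : R) (delta_gt0 : 0 < delta)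
    (rho : R) (rho_ge : Num.max (2 * max_len G) 1 <= rho)
    (psi : R -> R) (psi_ok : is_psi (- (max_len G / rho)) delta psi)
    (u : gpoint G -> R) (u_sol : is_solution mu omega V sigma u)
    (u_X : X_space mu (vpt x0) (delta / rho) u) :
  let Psi := test_fun eta psi (vpt x0) rho in
  [/\ integrable_V mu (fun x => Psi (vpt x) * lap_V mu omega u x),
      integrable_E (fun e t => Psi (ept e t) * lap_E u e t),
      integrable_V mu (fun x => u (vpt x) * lap_V mu omega Psi x),
      integrable_E (fun e t => u (ept e t) * lap_E Psi e t) &
      (int_V mu (fun x => (Psi (vpt x) * lap_V mu omega u x)%R)
       + int_E (fun e t => (Psi (ept e t) * lap_E u e t)%R)
       = int_V mu (fun x => (u (vpt x) * lap_V mu omega Psi x)%R)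
         + int_E (fun e t => (u (ept e t) * lap_E Psi e t)%R))%E].
Proof.
move=> Psi.
have conn := graph_connected standing.
have ub := graph_len_bounded standing.
have rho1 : 1 <= rho by apply: le_trans rho_ge; rewrite le_max lexx orbT.
have rho0 : 0 < rho := lt_le_trans ltr01 rho1.
have j0 := max_len_ge0 ub.
have len_le (e : edge G) := len_le_max e ub.
have len_ge (e : edge G) := min_len_le e.
have r0 := graph_len_pos standing.
have alpha0 : 0 <= delta / rho by rewrite divr_ge0// ltW.
pose W (x : gpoint G) := expR (- (delta / rho * dist x (vpt x0))).
have W0 x : 0 <= W x by exact: expR_ge0.
have E0 : 0 <= expR (delta / rho * max_len G) by exact: expR_ge0.
have [K K0 [PV PE]] := test_fun_jets conn r0 len_ge len_le j0 x0 eta_ok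
  delta_gt0 rho1 psi_ok (erefl _).
have [C [s0 [s1 [s2 [step _]]]]] := eta_extension eta_ok.
(* the equation makes the solution concave on every edge *)
have u_concave (e : edge G) (t : R) : 0 < t < len e -> lap_E u e t <= 0.
  move=> te; have := solution_E u_sol te.
  by apply: le_trans; rewrite lerDl mulr_ge0 ?powR_ge0// ltW.
have sV0 : (0 <= \esum_(v in [set: vertex G]) (mu v * `|u (vpt v)| * W (vpt v))%:E)%E.
  by apply: esum_ge0 => v _; rewrite lee_fin !mulr_ge0// ltW.
have sE0 : (0 <= \esum_(e in [set: edge G]) \int[lebesgue_measure]_(t in `]0%R, len e[)
      (`|on_edge u e t| * W (ept e t))%:E)%E.
  by apply: esum_ge0 => e _; apply: integral_ge0 => t _; rewrite lee_fin mulr_ge0.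
have uV := le_lt_trans (leeDl _ sE0) u_X.
have uE := le_lt_trans (leeDr _ sV0) u_X.
have [Cw Cw0 omC] := graph_weight_bound standing.
have [iV1 iV2 eV] := vertex_green mu_gt0 omega_gt0 omega_sym
  (graph_locally_finite standing) (ltW Cw0) K0 E0 (fun v => W0 (vpt v)) omC PV
  (weight_adj conn x0 len_le alpha0) uV.
have [iE1 iE2 eE] := edge_green (solution_domain u_sol) u_concave
  (solution_kirchhoff u_sol) (graph_locally_finite standing)
  (graph_loopless standing) K0 E0 r0 len_ge step PE PV W0
  (weight_edge conn x0 len_le alpha0) (weight_measurable conn (delta / rho) x0) uE.
split; [exact: iV1|exact: iE1|exact: iV2|exact: iE2|].
exact: (f_equal2 adde eV eE).
Qed.
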